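(* Let $G$ be a connected cycle-disjoint graph with $n$ vertices, $m$ edges, and $c_1$ induced cycles of length congruent to $1$ modulo $3$. Then $\mathrm{diss}(G)= n-\frac{1}{3}(m+1+c_1)$ if and only if $G\in\mathcal{C}$.
   Context: A graph is cycle-disjoint if every two distinct cycles of it are vertex-disjoint. A set $D$ of vertices of a graph $G$ is a dissociation set if the induced subgraph $G[D]$ has maximum degree at most $1$; $\mathrm{diss}(G)$ is the maximum cardinality of a dissociation set. An induced cycle is a cycle subgraph $C$ with $G[V(C)]=C$. Spiked cycles: for positive integers $\ell,k$ with $\ell\geq\max\{3,k\}$ and indices $1\le i_1<\dots<i_k\le \ell$, the spiked cycle $C^*$ with $k$ spikes at $\{i_1,\dots,i_k\}$ arises from the cycle $u_1u_2\dots u_\ell u_1$ by adding, for each $j$, a new vertex $v_{i_j}$ adjacent only to $u_{i_j}$. It is good if either $k=1$ and $\ell\equiv 1\pmod 3$, or $k\ge 2$, $i_{j+1}-i_j\equiv 2\pmod 3$ for all $j\in\{1,\dots,k-1\}$, and $\ell+i_1-i_k\equiv 1\pmod 3$. It is very good if it is good and $\ell\not\equiv 1\pmod 3$. Operations on a graph $G'$: $(O_1)$ add new vertices $u,v,w$ with edges $uv,vw$ and an edge from $w$ to some vertex of $G'$; $(O_2)$ add new vertices $v,u,u'$ with edges $vu,vu'$ and an edge from $v$ to some vertex of $G'$; $(O_3)$ add a disjoint new cycle $C_\ell$ with $\ell\ge 3$, $\ell\not\equiv 0\pmod 3$, and an edge from some vertex of the cycle to some vertex of $G'$; $(O_4)$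 add a disjoint new very good spiked cycle $C^*$ and an edge between some vertex of $G'$ and some vertex of $C^*$. Let $\mathcal{C}_0$ consist of $P_3$, all cycles $C_\ell$ with $\ell\ge 3$ and $\ell\not\equiv 0\pmod 3$, and all very good spiked cycles. $\mathcal{C}$ is the set of all graphs obtained from graphs in $\mathcal{C}_0$ by finitely many (possibly zero) applications of the operations $(O_1)$, $(O_2)$, $(O_3)$, $(O_4)$. *)

(* Defs.v *)
From mathcomp Require Import all_boot all_order all_algebra.
Set Implicit Arguments.
Unset Strict Implicit.
Unset Printing Implicit Defensive.

Section Graphs.
Variable T : finType.
Variable e : rel T.

Definition connected_graph : Prop := forall x y : T, connect e x y.

Definition is_cycle (p : seq T) : bool := [&& uniq p, 3 <= size p & cycle e p].

Definition cedges (p : seq T) : {set {set T}} := [set [set x; next p x] | x in p].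

Definition cycle_disjoint : Prop :=
  forall p q : seq T, is_cycle p -> is_cycle q -> cedges p != cedges q ->
    forall x, x \in p -> x \notin q.

(* S is the vertex set of an induced cycle C, i.e. C is a cycle with G[V(C)] = C;
   an induced cycle is determined by its vertex set. *)
Definition induced_cycle_set (S : {set T}) : bool :=
  [exists t : (#|S|).-tuple T,
     [&& is_cycle t, [set x in t] == S &
         [forall x, forall y, ((x \in S) && (y \in S) && e x y) ==>
                              ((y == next t x) || (x == next t y))]]].

Definition c1 : nat := #|[set S : {set T} | induced_cycle_set S & #|S| %% 3 == 1]|.

Definition n_edges : nat := #|[set E : {set T} | [exists x, exists y, e x y && (E == [set x; y])]]|.

Definition dissociation (D : {set T}) : bool :=
  [forall x in D, #|[set y in D | e x y]| <= 1].

Definition diss : nat := \max_(D : {set T} | dissociation D) #|D|.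

Definition P3_on (X : {set T}) (u v w : T) : Prop :=
  [/\ X = [set u; v; w], u != v, v != w, u != w &
      forall x y, x \in X -> y \in X ->
        (e x y <-> [\/ x = u /\ y = v, x = v /\ y = u, x = v /\ y = w | x = w /\ y = v])].

Definition cycle_on (X : {set T}) (l : nat) (u : nat -> T) : Prop :=
  [/\ 3 <= l,
      (forall i j, 0 < i <= l -> 0 < j <= l -> u i = u j -> i = j),
      (forall x, x \in X <-> exists2 i, 0 < i <= l & u i = x) &
      (forall x y, x \in X -> y \in X ->
        (e x y <-> exists2 i, 0 < i <= l &
            (x = u i /\ y = u (i %% l).+1) \/ (y = u i /\ x = u (i %% l).+1)))].

Definition spiked_on (X : {set T}) (l : nat) (idx : seq nat) (u v : nat -> T) : Prop :=
  [/\ [&& 3 <= l, 0 < size idx, sorted ltn idx & all (fun i => 0 < i <= l) idx],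
      [/\ (forall i j, 0 < i <= l -> 0 < j <= l -> u i = u j -> i = j),
          (forall i j, i \in idx -> j \in idx -> v i = v j -> i = j) &
          (forall i j, 0 < i <= l -> j \in idx -> u i <> v j)],
      (forall x, x \in X <-> (exists2 i, 0 < i <= l & u i = x) \/
                             (exists2 i, i \in idx & v i = x)) &
      (forall x y, x \in X -> y \in X ->
        (e x y <-> (exists2 i, 0 < i <= l &
            (x = u i /\ y = u (i %% l).+1) \/ (y = u i /\ x = u (i %% l).+1)) \/
                   (exists2 i, i \in idx & (x = u i /\ y = v i) \/ (y = u i /\ x = v i))))].

End Graphs.

Definition good_spikes (l : nat) (idx : seq nat) : bool :=
  let k := size idx in
  ((k == 1) && (l %% 3 == 1)) ||
  [&& 2 <= k,
      all (fun j => (nth 0 idx j.+1 - nth 0 idx j) %% 3 == 2) (iota 0 k.-1) &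
      (l + head 0 idx - last 0 idx) %% 3 == 1].

Definition very_good_spikes (l : nat) (idx : seq nat) : bool :=
  good_spikes l idx && (l %% 3 != 1).

Definition attached (T : finType) (e : rel T) (X : {set T}) (a z : T) : Prop :=
  [/\ a \in X, z \notin X &
      forall x y, x \in X -> y \notin X -> (e x y <-> x = a /\ y = z)].

Definition rest (T : finType) (X : {set T}) : finType := {x : T | x \notin X}.
Definition del_rel (T : finType) (e : rel T) (X : {set T}) : rel (rest X) :=
  fun a b => e (val a) (val b).

(* The class C: generated from C0 by operations O1--O4.  A graph G arises from
   G' by an operation iff G has a vertex set X carrying the added structure,
   with G - X = G' (the operations only add new vertices and edges incident
   to them). *)
Inductive inC : forall T : finType, rel T -> Prop :=
| C0_P3 (T : finType) (e : rel T) u v w :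
    P3_on e setT u v w -> inC e
| C0_cycle (T : finType) (e : rel T) l u :
    cycle_on e setT l u -> l %% 3 != 0 -> inC e
| C0_spiked (T : finType) (e : rel T) l idx u v :
    spiked_on e setT l idx u v -> very_good_spikes l idx -> inC e
| C_O1 (T : finType) (e : rel T) (X : {set T}) u v w z :
    P3_on e X u v w -> attached e X w z -> inC (@del_rel T e X) -> inC e
| C_O2 (T : finType) (e : rel T) (X : {set T}) v u u' z :
    P3_on e X u v u' -> attached e X v z -> inC (@del_rel T e X) -> inC e
| C_O3 (T : finType) (e : rel T) (X : {set T}) l u a z :
    cycle_on e X l u -> l %% 3 != 0 -> attached e X a z ->
    inC (@del_rel T e X) -> inC e
| C_O4 (T : finType) (e : rel T) (X : {set T}) l idx u v a z :
    spiked_on e X l idx u v -> very_good_spikes l idx -> attached e X a z ->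
    inC (@del_rel T e X) -> inC e.

(* Main.v *)
Require Import Defs.
From mathcomp Require Import all_boot all_order all_algebra.
From mathcomp Require Import zify.
Set Implicit Arguments.
Unset Strict Implicit.
Unset Printing Implicit Defensive.

(** All quantities are attached to vertex sets A of the fixed graph.  The weight
    of A is |A| plus, for every cycle inside A, 2 if its length is 1 mod 3 and 1
    otherwise; for a connected cycle-disjoint graph this is m + 1 + c_1, because
    m + 1 - n is the number of cycles.  With tau A the least number of vertices
    whose deletion turns A into a dissociation set, 3 tau <= weight, and the
    theorem characterizes the tight graphs, those with equality.

    Since tau is an integer, a part of weight w has slack at least w mod 3.
    Deleting one vertex (or two vertices of a cycle) of a tight graph therefore
    forces the residues of the remaining parts.  In a tight tree some vertex has
    two hanging parts of residue 1, which exhibits a P_3.  Around a cycle the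
    hanging parts have residue 0, except for at most one of residue 1 at each
    cycle vertex, which gives a spike; deleting pairs of spiked vertices shows
    that the spiked cycle is very good.  All other parts are tight again, so a
    tight connected graph is a tree of pieces joined by single edges.

    Conversely tau is superadditive and the weight is additive over such trees,
    and each piece is tight: winding three times around a cycle, or twice around
    a very good spiked cycle, yields sufficiently many copies of P_3. *)

(** * Components and cycles *)

(** Two obstacles shape the development. The bound does not follow by plain induction: deletion sets
    of two graphs joined by an edge need not combine, since the new edge may raise a degree; hence
    the induction also controls the end of that edge. And [inC] changes the vertex type with every
    operation, whereas the decomposition cuts one graph in many ways; hence the work is done for
    vertex sets of one graph, with [piece_tree] in place of [inC], and the two are compared only at
    the end.

    The residues come from one budget. Deleting a vertex costs 3 in [3 * tau]; it lowers the weight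
    by 1 if the vertex lies on no cycle, and by 2 or 3 if it lies on one. In a tight graph the
    remaining parts therefore share a slack of at most 2, 1 or 0. This gives the residues 1 + 1 at
    the centre of a P_3, the single spike at a cycle vertex, and the absence of spikes on cycles of
    length 1 modulo 3. *)

Section Components.
Variables (T : finType) (e : rel T).
Hypothesis symE : symmetric e.
Implicit Types (A B K Q : {set T}) (x y z : T).

Lemma disjointDl A B : [disjoint A :\: B & B].
Proof. by rewrite -setI_eq0; apply/eqP/setP => z; rewrite !inE; case: (z \in B); rewrite ?andbF. Qed.

Lemma disjointUs A B K : [disjoint A :|: B & K] = [disjoint A & K] && [disjoint B & K].
Proof. by rewrite -!setI_eq0 setIUl setU_eq0. Qed.

Lemma setDUK A B : B \subset A -> A :\: B :|: B = A.
Proof.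
move=> /subsetP BA; apply/setP => z; rewrite !inE.
by case: (boolP (z \in B)) => [/BA ->|]; rewrite ?orbF.
Qed.

Definition indrel A : rel T := [rel x y | [&& x \in A, y \in A & e x y]].
Definition component A x : {set T} := [set y | connect (indrel A) x y].
Definition clos K A := K \subset A /\ forall a b, a \in K -> b \in A -> e a b -> b \in K.
(** Together with [clos], whose closed sets [K] are the unions of components of the subgraph induced
    on [A], this replaces reasoning about induced subgraphs as separate types. *)
Definition conn A := forall x y, x \in A -> y \in A -> y \in component A x.

Lemma indrel_sym A : symmetric (indrel A).
Proof. by move=> x y; rewrite /indrel /= symE; case: (x \in A); case: (y \in A). Qed.

Lemma comp_refl A x : x \in component A x.
Proof. by rewrite inE connect0. Qed.

Lemma comp_eq A x y : y \in component A x -> component A y = component A x.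
Proof.
rewrite inE => xy; apply/setP=> z; rewrite !inE.
by rewrite (same_connect (sym_connect_sym (@indrel_sym A)) xy).
Qed.

Lemma comp_closed A K x y :
  (forall a b, a \in K -> b \in A -> e a b -> b \in K) ->
  x \in K -> y \in component A x -> y \in K.
Proof.
move=> clK xK; rewrite inE => /connectP[p pth ->] {y}.
elim: p x xK pth => [|z p IH] x xK //= /andP[/and3P[xA zA xz] pth].
by apply: IH pth; apply: clK xz.
Qed.

Lemma comp_sub A x : x \in A -> component A x \subset A.
Proof. by move=> xA; apply/subsetP => y; apply: comp_closed. Qed.

Lemma comp_step A x y z : x \in A ->
  y \in component A x -> z \in A -> e y z -> z \in component A x.
Proof.
move=> xA yx zA yz; have yA := subsetP (comp_sub xA) _ yx.
move: yx; rewrite !inE => /connect_trans; apply.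
by apply: connect1; rewrite /indrel /= yA zA.
Qed.

Lemma clos_comp A x : x \in A -> clos (component A x) A.
Proof.
by move=> xA; split; [apply: comp_sub | move=> a b ax bA; apply: comp_step].
Qed.

Lemma comp_clos K A x : clos K A -> x \in K -> component K x = component A x.
Proof.
move=> [KA clK] xK; apply/eqP; rewrite eqEsubset; apply/andP; split.
  apply/subsetP=> y; rewrite !inE; apply: connect_sub => a b /and3P[aK bK ab].
  by apply: connect1; rewrite /indrel /= (subsetP KA _ aK) (subsetP KA _ bK).
apply/subsetP=> y; apply: comp_closed (comp_refl _ _) => a b ak bA ab.
have aK := subsetP (comp_sub xK) _ ak.
exact: comp_step xK ak (clK _ _ aK bA ab) ab.
Qed.

Lemma conn_comp A x : x \in A -> conn (component A x).
Proof.
move=> xA y z yx zx; rewrite (comp_clos (clos_comp xA) yx).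
by rewrite (comp_eq yx).
Qed.

Lemma closD K A : clos K A -> clos (A :\: K) A.
Proof.
move=> [KA clK]; split; first exact: subsetDl.
move=> a b /setDP[aA aK] bA ab; rewrite inE bA andbT.
by apply: contra aK => bK; apply: clK bK aA _; rewrite symE.
Qed.

Lemma clos_sub K B A : clos K A -> K \subset B -> B \subset A -> clos K B.
Proof.
move=> [KA clK] KB BA; split=> // a b aK bB; apply: clK => //.
exact: (subsetP BA).
Qed.

Lemma clos_trans K B A : clos K B -> clos B A -> clos K A.
Proof.
move=> [KB clK] [BA clB]; split; first exact: subset_trans KB BA.
move=> a b aK bA ab; apply: (clK a) => //; apply: (clB a) => //.
exact: (subsetP KB).
Qed.

Lemma clos_notin K A a b : clos K A -> a \in K -> b \in A -> b \notin K -> e a b = false.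
Proof.
by move=> [KA clK] aK bA; apply: contraNF => ab; apply: clK ab.
Qed.

(** Otherwise the component would be closed in all of [A], and connectedness would make it reach
    [Q]. *)
Lemma conn_edge A Q x : conn A -> Q \subset A -> Q != set0 -> x \in A :\: Q ->
  exists y z, [/\ y \in component (A :\: Q) x, z \in Q & e y z].
Proof.
move=> cA QA /set0Pn[q qQ] xAQ; have /setDP[xA xQ] := xAQ.
have [/existsP[y /existsP[z /and3P[? ? ?]]]|nex] :=
  boolP [exists y, exists z, [&& y \in component (A :\: Q) x, z \in Q & e y z]].
  by exists y, z.
suff : q \in component (A :\: Q) x.
  by move=> /(subsetP (comp_sub xAQ)); rewrite inE qQ.
have qx := cA x q xA (subsetP QA _ qQ).
apply: comp_closed (comp_refl _ _) qx => a b ax bA ab.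
have [bQ|bQ] := boolP (b \in Q); last first.
  by apply: comp_step ab => //; rewrite inE bQ.
case/negP: nex; apply/existsP; exists a; apply/existsP; exists b.
by rewrite ax bQ.
Qed.

End Components.

Arguments comp_sub {T} e {A x} _.
Arguments clos_comp {T} e {A x} _.

(** * Cycles of a cycle-disjoint graph and the weight *)

Section Cycles.
Variables (T : finType) (e : rel T).
Hypotheses (symE : symmetric e) (irrE : irreflexive e) (cdE : cycle_disjoint e).
Implicit Types (A B C K Q S X Y : {set T}) (x y z : T).

(** A cycle is represented by its vertex set: in a cycle-disjoint graph two cycles on the same
    vertices have the same edges, so sums over cycles become sums over sets. *)
Definition cyc S := [exists t : #|S|.-tuple T, is_cycle e t && ([set x in t] == S)].

Lemma cycP S : reflect (exists2 p, is_cycle e p & [set x in p] = S) (cyc S).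
Proof.
apply: (iffP existsP) => [[t /andP[ct /eqP tS]]|[p cp pS]]; first by exists t.
have sz : size p == #|S|.
  by rewrite -pS cardsE; apply/eqP/esym/card_uniqP; case/and3P: cp.
by exists (Tuple sz); rewrite cp /= pS.
Qed.

(** Cycle-disjointness speaks of edge sets; it passes to vertex sets because the vertices of a cycle
    are the union of its edges. *)
Lemma cyc_eq S S' x : cyc S -> cyc S' -> x \in S -> x \in S' -> S = S'.
Proof.
move=> /cycP[p cp pS] /cycP[q cq qS] xS xS'.
have cov (r : seq T) : [set y in r] = cover (cedges r).
  apply/setP => y; rewrite inE; apply/idP/bigcupP => [yr|[_ /imsetP[z zr ->]]].
    by exists [set y; next r y]; [apply/imsetP; exists y | rewrite !inE eqxx].
  by rewrite !inE => /orP[] /eqP-> //; rewrite mem_next.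
have [eqc|neqc] := eqVneq (cedges p) (cedges q).
  by rewrite -pS -qS !cov eqc.
have := cdE cp cq neqc (x := x); move: xS xS'; rewrite -pS -qS !inE => -> xq.
by move=> /(_ isT); rewrite xq.
Qed.

Lemma is_cycle_rot p n : is_cycle e p -> is_cycle e (rot n p).
Proof. by rewrite /is_cycle rot_uniq size_rot rot_cycle. Qed.

Lemma cyc_cons S x : cyc S -> x \in S ->
  exists2 p, is_cycle e (x :: p) & [set y in x :: p] = S.
Proof.
move=> /cycP[p cp pS] xS; have xp : x \in p by move: xS; rewrite -pS inE.
have [i q def] := rot_to xp; exists q; rewrite -def; first exact: is_cycle_rot.
by rewrite -pS; apply/setP => y; rewrite !inE mem_rot.
Qed.

Lemma cyc_card S : cyc S -> 2 < #|S|.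
Proof.
move=> /cycP[p /and3P[up sp _] <-]; rewrite cardsE.
by move/card_uniqP: up => ->.
Qed.

Lemma upath_comp B q q' : q \in B -> q' \in component e B q ->
  exists p, [/\ path e q p, last q p = q', uniq (q :: p) & {subset q :: p <= B}].
Proof.
move=> qB; rewrite inE => /connectP[p pth ->].
case/shortenP: pth => p' pth' up _; exists p'; split=> //.
  by apply: sub_path pth' => a b /and3P[].
move=> z; rewrite inE => /predU1P[-> //|].
elim: p' q {up qB} pth' => //= a p' IH q /andP[/and3P[qB aB _] pth].
by rewrite inE => /predU1P[-> //|]; exact: IH pth.
Qed.

Lemma is_cycle_cons x p : p != [::] -> size p > 1 ->
  uniq (x :: p) -> path e (head x p) (behead p) -> e x (head x p) -> e (last x p) x ->
  is_cycle e (x :: p).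
Proof.
case: p => [|y p] // _ sp u /= pth exy elx; apply/and3P; split=> //.
by rewrite /= exy rcons_path pth.
Qed.

Lemma cyc_nbrs B r q q' : r \notin B -> q \in B -> q' \in component e B q -> q != q' ->
  e r q -> e r q' ->
  exists S, [/\ cyc S, r \in S, q \in S, q' \in S & S \subset r |: B].
Proof.
move=> rB qB qq' nq rq rq'.
have [p [pth lp up sub]] := upath_comp qB qq'.
have cp : is_cycle e (r :: q :: p).
  apply: is_cycle_cons => //=; last by rewrite lp symE.
    by case: p lp {pth up sub} => //= E; rewrite E eqxx in nq.
  by move: up => /= ->; rewrite andbT; apply: contra rB => /sub.
exists [set y in r :: q :: p]; split; first by apply/cycP; exists (r :: q :: p).
- by rewrite !inE eqxx.
- by rewrite !inE eqxx orbT.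
- by rewrite inE inE -lp mem_last orbT.
- by apply/subsetP => y; rewrite !inE => /predU1P[-> |/sub ->]; rewrite ?eqxx ?orbT.
Qed.

(** With two contacts on [C], a path through [B] could replace one arc between them and give a
    second cycle meeting [C]; with one contact and two edges, the path closes through that
    contact. *)
Lemma cyc_comp C B u u' q q' : cyc C -> [disjoint B & C] -> u \in C -> u' \in C ->
  q \in B -> q' \in component e B q -> e u q -> e u' q' -> u = u' /\ q = q'.
Proof.
move=> cC dBC uC u'C qB qq' uq uq'.
have nBC z : z \in B -> z \in C -> False by move=> zB; rewrite (disjointFr dBC).
have [eu|nu] := eqVneq u u'.
  subst u'; split=> //; apply/eqP; apply: contraT => nq.
  have uB : u \notin B by apply/negP => uB; apply: nBC uB uC.
  have [S [cS uS qS _ _]] := cyc_nbrs uB qB qq' nq uq uq'.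
  by have := nBC _ qB; rewrite (cyc_eq cC cS uC uS) qS => /(_ isT).
have [p cp pC] := cyc_cons cC uC.
have : u' \in p by move: u'C; rewrite -pC !inE eq_sym (negPf nu).
move=> u'p; case/splitPr: u'p cp pC => p1 p2 cp pC.
have [p' [pth lp up sub]] := upath_comp qB qq'.
have sz : 2 < size (u' :: p2 ++ u :: q :: p') by rewrite /= size_cat /=; lia.
(* The arc [p1] from [u] to [u'] is replaced by the path through [B]. *)
have cp' : is_cycle e (u' :: p2 ++ u :: q :: p').
  move: cp; rewrite -cat_cons /is_cycle uniq_catC cycle_catC => /and3P[U _ cy].
  rewrite sz andTb; apply/andP; split; last first.
    move: cy; rewrite /= !rcons_cat /= !cat_path /= => /and3P[-> -> _] /=.
    by rewrite uq rcons_path pth lp symE.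
  have nq z : z \in q :: p' -> z \notin u :: (u' :: p2).
    move=> /sub zB; apply/negP => zz; apply: (nBC z zB); rewrite -pC !inE mem_cat inE.
    by move: zz; rewrite !inE => /or3P[]->; rewrite ?orbT.
  move: U; rewrite cat_uniq => /and3P[U1 /hasPn H1 _].
  rewrite -cat_cons cat_uniq; apply/and3P; split=> //; last rewrite cons_uniq up andbT.
    apply/hasPn => z; rewrite inE => /predU1P[->|/nq].
      by apply: H1; rewrite mem_head.
    by rewrite inE => /norP[].
  by apply/negP => /nq; rewrite mem_head.
have cS : cyc [set y in u' :: p2 ++ u :: q :: p'].
  by apply/cycP; exists (u' :: p2 ++ u :: q :: p').
have := cyc_eq cC cS u'C; rewrite inE mem_head => /(_ isT) E.
by case: (nBC q qB); rewrite E inE -cat_cons mem_cat !inE eqxx !orbT.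
Qed.

(** A chord with vertices on both sides cuts off a shorter cycle that shares [x] with the given one
    and misses the other side. Hence cycles are induced. *)
Lemma cyc_chord x y p1 p2 : is_cycle e (x :: p1 ++ y :: p2) -> e x y ->
  p1 = [::] \/ p2 = [::].
Proof.
move=> cp xy; case: p1 cp => [|z p1] cp; [by left | right].
case: p2 cp => // t p2 cp.
have cp' : is_cycle e (x :: rcons (z :: p1) y).
  case/and3P: cp => U _ cy; apply/and3P; split.
  - move: U; rewrite -cats1 -[y :: _]cat1s catA -cat_cons cat_uniq.
    by case/andP.
  - by rewrite /= size_rcons.
  - move: cy; rewrite /cycle -[y :: t :: p2]cat1s catA cats1 rcons_cat cat_path.
    by move=> /andP[pth _]; rewrite rcons_path pth last_rcons symE.
pose S1 := [set v in x :: (z :: p1) ++ y :: t :: p2].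
pose S2 := [set v in x :: rcons (z :: p1) y].
have E : S1 = S2.
  apply: (@cyc_eq S1 S2 x); rewrite ?[_ \in S1]inE ?[_ \in S2]inE ?mem_head //.
    by apply/cycP; exists (x :: (z :: p1) ++ y :: t :: p2).
  by apply/cycP; exists (x :: rcons (z :: p1) y).
have : t \in S1 by rewrite inE -cat_cons mem_cat !inE eqxx !orbT.
rewrite E inE => tS; case/and3P: cp => U _ _.
move: U; rewrite -[y :: t :: p2]cat1s catA cats1 -cat_cons cat_uniq => /and3P[_ /hasPn H _].
by have := H t (mem_head _ _); rewrite tS.
Qed.

Lemma cyc_induced p x y : is_cycle e p -> x \in p -> y \in p -> e x y ->
  y = next p x \/ x = next p y.
Proof.
move=> cp xp yp xy; have up : uniq p by case/and3P: cp.
have [i q def] := rot_to xp; rewrite -!(next_rot i up) def.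
have cq : is_cycle e (x :: q) by rewrite -def is_cycle_rot.
have : y \in q.
  have : y \in x :: q by rewrite -def mem_rot.
  by rewrite inE => /predU1P[E|//]; rewrite E irrE in xy.
move=> yq; case/splitPr: yq cq => p1 p2 cq; have [E|E] := cyc_chord cq xy.
  by left; rewrite E /= eqxx.
right; subst p2; have uq : uniq (x :: p1 ++ [:: y]) by case/and3P: cq.
rewrite -(next_rotr 1 uq) cats1 -rcons_cons rotr1_rcons /= eqxx //.
Qed.

Lemma next_closed (P : pred T) p a x : uniq p -> a \in p ->
  (forall z, z \in p -> P z -> P (next p z)) -> P a -> x \in p -> P x.
Proof.
move=> up ap clP Pa xp; have [i q def] := rot_to ap.
have cy : fcycle (next p) (a :: q) by rewrite -def rot_cycle cycle_next.
have sub : {subset a :: q <= p} by move=> z; rewrite -def mem_rot.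
have : x \in a :: q by rewrite -def mem_rot.
move: cy => /=; rewrite rcons_path => /andP[pth _] {def}.
elim: q a {ap} Pa pth sub => [|b q IH] a Pa /=; first by rewrite inE => _ _ /eqP->.
move=> /andP[/eqP nab pth] sub; rewrite inE => /predU1P[->//|].
apply: IH => //; last by move=> z zq; apply: sub; rewrite inE zq orbT.
by rewrite -nab; apply: clP => //; apply: sub; rewrite mem_head.
Qed.

Lemma next_next p x : uniq p -> 2 < size p -> x \in p -> next p (next p x) != x.
Proof.
move=> up sp xp; have [i q def] := rot_to xp.
rewrite -!(next_rot i up) def; move: up sp; rewrite -(rot_uniq i) -(size_rot i) def.
case: q {def} => [|y [|z q]] //= ; rewrite !inE !negb_or => /andP[/and3P[xy xz _] _] _.
by rewrite !eqxx [y == x]eq_sym (negPf xy) eq_sym.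
Qed.

Lemma cyc_two_nbrs S x : cyc S -> x \in S ->
  exists y z, [/\ y \in S, z \in S, y != z, e x y & e x z].
Proof.
move=> /cycP[p cp <-]; rewrite inE => xp; case/and3P: (cp) => up sp cy.
exists (next p x), (prev p x); split; rewrite ?inE ?mem_next ?mem_prev //.
- have yp : prev p x \in p by rewrite mem_prev.
  by have := next_next up sp yp; rewrite next_prev.
- exact: next_cycle.
- by rewrite symE prev_cycle.
Qed.

Lemma cyc_nbrs_le2 S x y z t : cyc S -> x \in S -> y \in S -> z \in S -> t \in S ->
  e x y -> e x z -> e x t -> [|| y == z, z == t | y == t].
Proof.
move=> /cycP[p cp <-]; rewrite !inE => xp yp zp tp xy xz xt.
have up : uniq p by case/and3P: cp.
have H v : v \in p -> e x v -> v = next p x \/ v = prev p x.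
  move=> vp xv; case: (cyc_induced cp xp vp xv) => ->; first by left.
  by right; rewrite prev_next.
case: (H y) => // ->; case: (H z) => // ->; case: (H t) => // ->; rewrite ?eqxx ?orbT //.
Qed.

Definition one_edge A B := forall x y x' y', x \in A -> x' \in A ->
  y \in B -> y' \in B -> e x y -> e x' y' -> x = x' /\ y = y'.

(** A cycle contained in neither side leaves [A] once and leaves [B] once. If both steps use the
    same edge, the cycle turns back after two steps, which its length forbids. *)
Lemma cyc_cut S A B : cyc S -> S \subset A :|: B -> one_edge A B ->
  (S \subset A) || (S \subset B).
Proof.
move=> /cycP[p cp <-] sub one; apply: contraT; rewrite negb_or => /andP[nA nB].
case/and3P: (cp) => up sp cy.
have pAB z : z \in p -> z \notin A -> z \in B.
  by move=> zp /negPf zA; have := subsetP sub z; rewrite !inE zp zA => /(_ isT).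
have pBA z : z \in p -> z \notin B -> z \in A.
  by move=> zp /negPf zB; have := subsetP sub z; rewrite !inE zp zB orbF => /(_ isT).
have key (P Q : {set T}) : (forall z, z \in p -> z \notin P -> z \in Q) ->
    (forall z, z \in p -> z \notin Q -> z \in P) ->
    ~~ ([set x in p] \subset P) -> ~~ ([set x in p] \subset Q) ->
    exists2 x, x \in p & (x \in P) && (next p x \notin P).
  move=> PQ QP /subsetPn[b]; rewrite inE => bp bP /subsetPn[a]; rewrite inE => ap aQ.
  have [/existsP[x /and3P[xp xP nx]]|nex] :=
    boolP [exists x, [&& x \in p, x \in P & next p x \notin P]].
    by exists x; rewrite ?xP.
  case/negP: bP; apply: (@next_closed (mem P) p a) => //=; last exact: QP.
  move=> z zp zP; apply: contraR nex => nz; apply/existsP; exists z.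
  by rewrite zp nz andbT.
have [a ap /andP[aA na]] := key A B pAB pBA nA nB.
have [b bp /andP[bB nb]] := key B A pBA pAB nB nA.
have na' := pAB _ (etrans (mem_next p a) ap) na.
have nb' := pBA _ (etrans (mem_next p b) bp) nb.
have ea := next_cycle cy ap; have eb := next_cycle cy bp.
have [E1 E2] := one a (next p a) (next p b) b aA nb' na' bB ea (etrans (symE _ _) eb).
by have := next_next up sp bp; rewrite -E1 E2 eqxx.
Qed.

Definition cyc_weight S := 1 + (#|S| %% 3 == 1).
Definition weight A := #|A| + \sum_(S : {set T} | cyc S && (S \subset A)) cyc_weight S.

Lemma weight_split A B : [disjoint A & B] -> one_edge A B -> weight (A :|: B) = weight A + weight B.
Proof.
move=> dAB one; rewrite /weight cardsU (disjoint_setI0 dAB) cards0 subn0.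
rewrite (bigID (fun S : {set T} => S \subset A)) /=.
rewrite (eq_bigl (fun S => cyc S && (S \subset A))); last first.
  move=> S; case: (cyc S) => //=; rewrite andbC; case: (boolP (S \subset A)) => //= SA.
  by rewrite (subset_trans SA) // subsetUl.
rewrite [X in _ + (_ + X)](eq_bigl (fun S => cyc S && (S \subset B))); first lia.
move=> S; case cS: (cyc S) => //=; apply/andP/idP.
  by move=> [sub nA]; have := cyc_cut cS sub one; rewrite (negPf nA).
move=> SB; rewrite (subset_trans SB) ?subsetUr //; split=> //; apply/negP => SA.
have /card_gt0P[x xS] : 0 < #|S| by have := cyc_card cS; lia.
by have := disjointFr dAB (subsetP SA _ xS); rewrite (subsetP SB).
Qed.

Lemma weight_rem A X : X \subset A -> (forall S, cyc S -> S \subset A -> [disjoint S & X]) ->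
  weight A = #|X| + weight (A :\: X).
Proof.
move=> XA nX; rewrite /weight addnA cardsD (setIidPr XA) subnKC ?subset_leq_card //.
congr (_ + _); apply: eq_bigl => S; case cS: (cyc S) => //=.
by rewrite subsetD; case SA: (S \subset A) => //=; rewrite nX.
Qed.

(** Only the term of [C] disappears: any other cycle meeting [X] would share a vertex with [C]. *)
Lemma weight_remC A C X : cyc C -> C \subset A -> X \subset C -> X != set0 ->
  weight A = #|X| + cyc_weight C + weight (A :\: X).
Proof.
move=> cC CA XC /set0Pn[x xX]; have XA := subset_trans XC CA.
rewrite /weight (bigD1 C) /= ?cC ?CA // cardsD (setIidPr XA).
have /subset_leq_card := XA.
rewrite (eq_bigl (fun S => cyc S && (S \subset A :\: X))); first lia.
move=> S; case cS: (cyc S) => //=; rewrite subsetD; case SA: (S \subset A) => //=.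
apply/idP/idP => [nSC|dSX].
  rewrite disjoint_sym; apply/pred0P => z /=; apply/negP => /andP[zX zS].
  by case/eqP: nSC; apply: (cyc_eq cS cC zS); apply: (subsetP XC).
by apply/eqP => E; have := disjointFl dSX xX; rewrite E (subsetP XC).
Qed.

Lemma weight_clos K A : clos e K A -> weight A = weight K + weight (A :\: K).
Proof.
move=> clK; have [KA _] := clK.
rewrite -weight_split; first by rewrite setDE setUIr setUCr setIT (setUidPr KA).
  by rewrite -setI_eq0 setIDA setIC -setIDA setDv setI0.
move=> x y x' y' xK _ /setDP[yA yK] _ xy.
by rewrite (clos_notin clK xK yA yK) in xy.
Qed.

End Cycles.

(** * The bound 3 tau <= weight *)

Section Tau.
Variables (T : finType) (e : rel T).
Hypotheses (symE : symmetric e).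
Implicit Types (A B C D K Q S X Y : {set T}) (x y z : T).

Lemma dissP D :
  reflect (forall x y z, x \in D -> y \in D -> z \in D -> e x y -> e x z -> y = z)
          (dissociation e D).
Proof.
apply: (iffP forall_inP) => H x; last first.
  move=> xD; apply/card_le1_eqP => y z; rewrite !inE => /andP[yD xy] /andP[zD xz].
  exact: (H x).
move=> y z xD yD zD xy xz.
by move/card_le1_eqP: (H x xD); apply; rewrite inE ?yD ?zD.
Qed.

Lemma dissU D D' : dissociation e D -> dissociation e D' ->
  (forall x y, x \in D -> y \in D' -> e x y = false) -> dissociation e (D :|: D').
Proof.
move=> /dissP dD /dissP dD' sep; apply/dissP => x y z.
rewrite !inE => /orP[xD|xD] /orP[yD|yD] /orP[zD|zD] xy xz;
  do ?[by apply: (dD x)|by apply: (dD' x)];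
  move: xy xz; do ?[by rewrite (sep x y)]; do ?[by rewrite (sep x z)];
  do ?[by rewrite symE (sep y x)]; do ?[by rewrite [e x z]symE (sep z x)].
Qed.

Lemma dissS D D' : D \subset D' -> dissociation e D' -> dissociation e D.
Proof.
move=> /subsetP sub /dissP H; apply/dissP => x y z xD yD zD.
by apply: H; apply: sub.
Qed.

(** Defined through the largest dissociation set, so that on the whole graph it is the order minus
    [diss]; [tau_le] and [tau_ex] recover the reading by deletion sets. *)
Definition tau A := #|A| - \max_(D : {set T} | dissociation e D && (D \subset A)) #|D|.

Lemma tau_le A X : dissociation e (A :\: X) -> tau A <= #|X|.
Proof.
move=> dX; rewrite /tau; set M := \max_(_ | _) _.
have : #|A :\: X| <= M by apply: leq_bigmax_cond; rewrite dX subsetDl.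
rewrite cardsD; have := subset_leq_card (subsetIr A X); lia.
Qed.

Lemma tau_ex A : exists X, [/\ X \subset A, dissociation e (A :\: X) & #|X| = tau A].
Proof.
rewrite /tau; set M := \max_(_ | _) _.
have : 0 < #|[pred D : {set T} | dissociation e D && (D \subset A)]|.
  apply/card_gt0P; exists set0; rewrite inE sub0set andbT.
  by apply/dissP => x y z; rewrite inE.
move=> /(eq_bigmax_cond (fun D : {set T} => #|D|))[D /andP[dD DA] ED].
exists (A :\: D); split; first exact: subsetDl.
  by rewrite setDDr setDv set0U (setIidPr DA).
by rewrite cardsD (setIidPr DA) /M ED.
Qed.

Lemma tau_rem A X : tau A <= #|X| + tau (A :\: X).
Proof.
have [Y [YA dY <-]] := tau_ex (A :\: X).
apply: leq_trans (tau_le (X := X :|: Y) _) _; first by rewrite -setDDl.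
by rewrite cardsU leq_subr.
Qed.

(** An optimal deletion set of the union restricts to both parts, whatever edges run between
    them. *)
Lemma tau_super A B : [disjoint A & B] -> tau A + tau B <= tau (A :|: B).
Proof.
move=> dAB; have [X [XA dX <-]] := tau_ex (A :|: B).
have E : #|X| = #|X :&: A| + #|X :&: B|.
  rewrite -[in LHS](setIidPl XA) setIUr cardsU.
  by rewrite setIACA setIid (disjoint_setI0 dAB) setI0 cards0 subn0.
have H (Z : {set T}) : Z \subset A :|: B -> tau Z <= #|X :&: Z|.
  move=> ZAB; apply: tau_le; apply: dissS dX; apply/subsetP => z; rewrite in_setD in_setI.
  move=> /andP[zX zZ]; rewrite inE (subsetP ZAB _ zZ) andbT.
  by move: zX; rewrite zZ andbT.
by rewrite E leq_add // H ?subsetUl ?subsetUr.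
Qed.

Lemma tau_clos K A : clos e K A -> tau A <= tau K + tau (A :\: K).
Proof.
move=> clK; have [KA _] := clK.
have [X [XK dX <-]] := tau_ex K; have [Y [YK dY <-]] := tau_ex (A :\: K).
apply: leq_trans (tau_le (X := X :|: Y) _) _; last by rewrite cardsU leq_subr.
apply: (@dissS _ ((K :\: X) :|: ((A :\: K) :\: Y))); last first.
  apply: dissU => // x y /setDP[xK _] /setDP[/setDP[yA yK] _].
  exact: clos_notin clK xK yA yK.
apply/subsetP => z; rewrite !inE negb_or => /andP[/andP[-> ->] ->].
by rewrite andbT orbN.
Qed.

Lemma tau0 : tau set0 = 0.
Proof. by rewrite /tau cards0. Qed.

End Tau.

(** * The rooted induction *)

Section Bound.
Variables (T : finType) (e : rel T).
Hypotheses (symE : symmetric e) (irrE : irreflexive e) (cdE : cycle_disjoint e).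
Implicit Types (A B C D K Q S X Y : {set T}) (x y z r q : T).
Local Notation w := (weight e).
Local Notation cyc := (cyc e).
Local Notation tau := (tau e).

(* Induction loading for the bound: the residue of the weight decides how much
   control over the root r is available when two graphs are joined at r. *)
Definition rcover A r := exists X,
  [/\ X \subset A, dissociation e (A :\: X), 3 * #|X| <= w A,
      w A %% 3 = 0 -> r \in X &
      w A %% 3 = 1 -> r \in X \/ forall y, y \in A :\: X -> e r y = false].

(** The edge [rq] does no harm if one end is deleted, or if both ends are isolated in what remains.
    If the residues add up to at least 3, rounding leaves room to delete [r] in addition; otherwise
    the conditions at the two roots provide one of these situations. *)
Lemma rcover_join A B r q : r \in A -> q \in B -> [disjoint A & B] ->
  (forall x y, x \in A -> y \in B -> e x y -> x = r /\ y = q) ->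
  rcover A r -> rcover B q -> rcover (A :|: B) r.
Proof.
move=> rA qB dAB one [X [XA dX cX X0 X1]] [Y [YB dY cY Y0 Y1]].
have wE : w (A :|: B) = w A + w B.
  apply: weight_split => // x y x' y' xA x'A yB y'B xy x'y'.
  by have [-> ->] := one _ _ xA yB xy; have [-> ->] := one _ _ x'A y'B x'y'.
have XYs : X :|: Y \subset A :|: B by apply: setUSS.
have cXY : #|X :|: Y| <= #|X| + #|Y| by rewrite cardsU leq_subr.
have dE (Z : {set T}) : X :|: Y \subset Z ->
    (A :|: B) :\: Z \subset (A :\: (X :|: Z)) :|: (B :\: (Y :|: Z)).
  move=> XYZ; apply/subsetP => z; rewrite !inE => /andP[zZ].
  have : z \notin X :|: Y by apply: contra zZ; apply: (subsetP XYZ).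
  by rewrite !inE !negb_or zZ => /andP[-> ->].
have dU (Z : {set T}) : X :|: Y \subset Z -> (r \in Z) || (q \in Z) ->
    dissociation e ((A :|: B) :\: Z).
  move=> XYZ rqZ; apply: dissS (dE Z XYZ) _; apply: dissU => //.
  - by apply: dissS dX; apply: setDS; apply: subsetUl.
  - by apply: dissS dY; apply: setDS; apply: subsetUl.
  move=> x y; rewrite !inE !negb_or => /andP[/andP[_ xZ] xA] /andP[/andP[_ yZ] yB].
  apply: contraTF rqZ => xy; have [<- <-] := one _ _ xA yB xy.
  by rewrite (negPf xZ) (negPf yZ).
have rB : r \notin B by rewrite (disjointFr dAB).
have qr y : y \in B -> e r y -> y = q by move=> yB ry; have [] := one _ _ rA yB ry.
(* Once [r] is deleted, both conditions at the root hold and only the budget matters. *)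
have cR (Z : {set T}) : Z = r |: (X :|: Y) -> 3 * #|Z| <= w A + w B -> rcover (A :|: B) r.
  move=> -> cZ; exists (r |: (X :|: Y)); split; rewrite ?wE //.
  - by rewrite subUset sub1set inE rA.
  - by apply: dU; rewrite ?subsetUr ?setU11.
  - by rewrite setU11.
  - by move=> _; left; rewrite setU11.
have [rX|rX] := boolP (r \in X).
  apply: (cR _ erefl); have -> : r |: (X :|: Y) = X :|: Y.
    by apply/setUidPr; rewrite sub1set inE rX.
  by clear -cXY cX cY; lia.
have X0' : w A %% 3 <> 0 by move=> /X0; rewrite (negPf rX).
have [qY|qY] := boolP (q \in Y).
  have [E|ltE] := ltnP (w A %% 3 + w B %% 3) 3; last first.
    apply: (cR _ erefl); rewrite cardsU1; move: cXY; move: (r \notin _) => b.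
    by clear -cX cY ltE; case: b => /=; lia.
  exists (X :|: Y); split=> //; rewrite ?wE.
  - by apply: dU => //; rewrite !inE qY !orbT.
  - by clear -cX cY cXY; lia.
  - by clear -E X0'; lia.
  - move=> E1; right => y; rewrite !inE negb_or => /andP[/andP[yX yY] yAB].
    have [rX'|H] := X1 ltac:(clear -E E1 X0'; lia); first by rewrite rX' in rX.
    case/orP: yAB => [yA|yB]; first by apply: H; rewrite inE yX.
    by apply/negP => ry; move: yY; rewrite (qr _ yB ry) qY.
have Y0' : w B %% 3 <> 0 by move=> /Y0; rewrite (negPf qY).
have [E|ltE] := ltnP (w A %% 3 + w B %% 3) 3; last first.
  apply: (cR _ erefl); rewrite cardsU1; move: cXY; move: (r \notin _) => b.
  by clear -cX cY ltE; case: b => /=; lia.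
(* Both residues are now 1, so [r] and [q] are isolated in their parts and at most an isolated edge
   arises. *)
have [rX'|Hr] := X1 ltac:(clear -E X0' Y0'; lia); first by rewrite rX' in rX.
have [qY'|Hq] := Y1 ltac:(clear -E X0' Y0'; lia); first by rewrite qY' in qY.
exists (X :|: Y); split=> //; rewrite ?wE; [|by clear -cX cY cXY E X0' Y0'; lia..].
apply: (@dissS _ _ _ ((A :\: X) :|: (B :\: Y))).
  have := dE _ (subxx _); rewrite setUA setUid; move/subset_trans; apply.
  by rewrite setUCA setUid setUSS // setDS // ?subsetUl ?subsetUr.
have HrA z : z \in A :\: X -> e z r = false by move=> zA; rewrite symE Hr.
have HqB z : z \in B :\: Y -> e z q = false by move=> zA; rewrite symE Hq.
have sep x y : x \in A :\: X -> y \in B :\: Y -> e x y -> x = r /\ y = q.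
  by move=> /setDP[xA _] /setDP[yB _]; apply: one.
apply/dissP => x y z.
move/dissP: dX => dX; move/dissP: dY => dY.
rewrite ![_ \in _ :|: _]in_setU => /orP[xA|xB] /orP[yA|yB] /orP[zA|zB] xy xz.
- exact: (dX x).
- by have [E1 _] := sep _ _ xA zB xz; move: xy; rewrite E1 Hr.
- by have [E1 _] := sep _ _ xA yB xy; move: xz; rewrite E1 Hr.
- by have [_ ->] := sep _ _ xA yB xy; have [_ ->] := sep _ _ xA zB xz.
- rewrite symE in xy; rewrite symE in xz.
  by have [-> _] := sep _ _ yA xB xy; have [-> _] := sep _ _ zA xB xz.
- rewrite symE in xy.
  by have [_ E1] := sep _ _ yA xB xy; move: xz; rewrite E1 Hq.
- rewrite symE in xz.
  by have [_ E1] := sep _ _ zA xB xz; move: xy; rewrite E1 Hq.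
- exact: (dY x).
Qed.

Lemma rcover_bound A r : rcover A r -> 3 * tau A <= w A.
Proof. by move=> [X [_ dX cX _ _]]; have := tau_le dX; lia. Qed.

(** If [r] lies on a cycle, deleting it lowers the weight by at least 2; this pays for [r] except
    when the residue is 2, and then the root is unconstrained and the graph may be cut elsewhere. If
    [r] lies on no cycle, some component of [A :\ r] has at most one edge to [r] and splits off. *)
Lemma rcover_ex A : forall r, r \in A -> rcover A r.
Proof.
have [n] := ubnP #|A|; elim: n A => // n IH A /ltnSE leA r rA.
have bnd B : B \proper A -> 3 * tau B <= w B.
  move=> /proper_card ltB; have [->|[s sB]] := set_0Vmem B; first by rewrite tau0.
  by apply: rcover_bound (IH B (leq_trans ltB leA) s sB).
have [/existsP[C /and3P[cC CA rC]]|noC] :=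
  boolP [exists C : {set T}, [&& cyc C, C \subset A & r \in C]].
  have wE : w A = 1 + cyc_weight C + w (A :\ r).
    rewrite (weight_remC cdE cC CA (X := [set r])) ?cards1 ?sub1set //.
    by apply/set0Pn; exists r; rewrite set11.
  have [X [XA dX cX]] := tau_ex e (A :\ r).
  have := bnd (A :\ r) (properD1 rA); rewrite -cX => {}cX.
  have [H|H] := leqP (3 * (#|X|).+1) (w A).
    have rX : r \notin X by apply/negP => /(subsetP XA); rewrite !inE eqxx.
    exists (r |: X); split.
    - by rewrite subUset sub1set rA (subset_trans XA) ?subD1set.
    - by rewrite -setDDl.
    - by rewrite cardsU1 rX.
    - by rewrite setU11.
    - by left; rewrite setU11.
  (* Failure of the budget forces equality: the cycle counts only 1, and the residue is 2. *)
  have [cwC w2 lC] : [/\ cyc_weight C = 1, w A %% 3 = 2 & #|C| %% 3 <> 1].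
    by move: wE cX H; clear; rewrite /cyc_weight; case: eqP => /= ? wE cX H; split; lia.
  (* A single cycle counting 1 has weight [#|C| + 1], of residue 2 only if [#|C|] is 1 modulo 3. *)
  have : A != C.
    apply/eqP => E; move: w2; rewrite E /weight (big_pred1 C) ?cwC; last first.
      move=> S /=; apply/andP/eqP => [[cS SC]|->]; last by rewrite cC subxx.
      have /card_gt0P[x xS] : 0 < #|S| by apply: ltn_trans (cyc_card cS).
      by apply: (cyc_eq cdE cS cC xS); apply: (subsetP SC).
    by move: lC; clear; lia.
  rewrite eqEsubset CA andbT => /subsetPn[x xA xC].
  have xAC : x \in A :\: C by rewrite inE xC.
  pose B := component e (A :\: C) x.
  have [BAC clB] := clos_comp e xAC; rewrite -/B in BAC clB.
  have dBC : [disjoint B & C].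
    by apply: disjointWl BAC (disjointDl _ _).
  have BA : B \subset A by apply: subset_trans BAC (subsetDl _ _).
  have xB : x \in B := comp_refl _ _ _.
  have dAB : [disjoint A :\: B & B].
    exact: disjointDl.
  have sub z : z \in C -> z \in A :\: B.
    by move=> zC; rewrite inE (subsetP CA) // andbT (disjointFl dBC).
  have EA : A :\: B :|: B = A by apply: setDUK.
  have AB : (A :\: B) \proper A by rewrite properEneq subsetDl andbT; apply/eqP => E; move: (xA); rewrite -E inE xB.
  have BB : B \proper A by rewrite properEneq BA andbT; apply/eqP => E; have := sub r rC; rewrite E setDv inE.
  (* The root moves to the contact [u] of the hanging component; with residue 2 nothing is asked of
     the original root. *)
  suff [u [q [uA qB one]]] : exists u q, [/\ u \in A :\: B, q \in B &
      forall x y, x \in A :\: B -> y \in B -> e x y -> x = u /\ y = q].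
    have rc : rcover A u.
      rewrite -EA; apply: (@rcover_join _ _ u q) => //; apply: IH => //.
        exact: leq_trans (proper_card AB) leA.
      exact: leq_trans (proper_card BB) leA.
    case: rc => Y [YA dY cY _ _]; by exists Y; split; rewrite ?w2.
  have toC z y : z \in A :\: B -> y \in B -> e z y -> z \in C.
    move=> /setDP[zA zB] yB zy; apply: contraR zB => zC; apply: clB yB _ _; last by rewrite symE.
    by rewrite inE zC.
  have [/existsP[u /existsP[q /and3P[uC qB uq]]]|nex] :=
    boolP [exists u, exists q, [&& u \in C, q \in B & e u q]]; last first.
    exists r, x; split=> //; first exact: sub.
    move=> z y zA yB zy; case/negP: nex; apply/existsP; exists z; apply/existsP; exists y.
    by rewrite yB zy (toC z y).
  exists u, q; split=> //; first exact: sub.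
  move=> z y zA yB zy; have zC := toC _ _ zA yB zy.
  apply: (cyc_comp symE cdE cC dBC zC uC yB _ zy uq).
  by apply: (conn_comp symE xAC).
have noCr S : cyc S -> S \subset A -> [disjoint S & [set r]].
  move=> cS SA; rewrite disjoint_sym disjoints1; apply: contra noC => rS.
  by apply/existsP; exists S; rewrite cS SA.
have [E1|[x xAr]] := set_0Vmem (A :\ r).
  have E : w A = 1 by rewrite (weight_rem (X := [set r]) _ noCr) ?sub1set // E1 cards1 /weight cards0 big1 // => S; rewrite subset0 => /andP[/cyc_card cS /eqP E]; rewrite E cards0 in cS.
  exists set0; rewrite E sub0set cards0 setD0; split=> //.
    apply/dissP => x y z xA yA zA xy; have : y \in A :\ r \/ x \in A :\ r.
      rewrite !inE xA yA !andbT; case: eqP => [Ey|_]; last by left.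
      by case: eqP => [Ex|_]; [rewrite Ex Ey irrE in xy | right].
    by rewrite E1 !inE; case.
  move=> _; right => y yA; apply/negP => ry; have : y \in A :\ r.
    by rewrite !inE yA andbT; apply/eqP => Ey; rewrite Ey irrE in ry.
  by rewrite E1 inE.
have [q qAr rq] : exists2 q, q \in A :\ r &
    forall y, y \in component e (A :\ r) q -> e r y -> y = q.
  (* If [r] has no neighbour, any vertex of the rest serves, because [rcover_join] needs no actual
     edge. *)
  have [/existsP[q /andP[qA rq]]|nex] := boolP [exists q, (q \in A :\ r) && e r q]; last first.
    exists x => // y yx ry; case/negP: nex; apply/existsP; exists y.
    by rewrite ry andbT (subsetP (comp_sub e xAr) _ yx).
  exists q => // y yq ry; apply/eqP; apply: contraT; rewrite eq_sym => nq.
  have rr : r \notin A :\ r by rewrite !inE eqxx.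
  have [S [cS rS _ _ SA]] := cyc_nbrs symE rr qA yq nq rq ry.
  case/negP: noC; apply/existsP; exists S; rewrite cS rS andbT.
  by rewrite setD1K in SA.
pose B := component e (A :\ r) q.
have [BAr clB] := clos_comp e qAr; rewrite -/B in BAr clB.
have qB : q \in B := comp_refl _ _ _.
have BA : B \subset A by apply: subset_trans BAr (subsetDl _ _).
have rB : r \notin B by apply/negP => /(subsetP BAr); rewrite !inE eqxx.
have dAB : [disjoint A :\: B & B].
  exact: disjointDl.
have EA : A :\: B :|: B = A.
  exact: setDUK.
have qA := subsetP BA _ qB.
rewrite -EA; apply: (@rcover_join _ _ r q) => //; first by rewrite inE rB.
- move=> z y /setDP[zA zB] yB zy; have E : z = r.
    apply/eqP; apply: contraR zB => zr; apply: clB yB _ _; last by rewrite symE.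
    by rewrite !inE zr.
  by split=> //; apply: rq => //; rewrite -E.
- apply: IH; last by rewrite inE rB.
  have : (A :\: B) \proper A.
    by rewrite properEneq subsetDl andbT; apply/eqP => E; move: qA; rewrite -E inE qB.
  by move/proper_card/leq_trans; apply.
- apply: IH => //; have : B \proper A.
    by rewrite properEneq BA andbT; apply/eqP => E; rewrite E rA in rB.
  by move/proper_card/leq_trans; apply.
Qed.

Lemma tau_bound A : 3 * tau A <= w A.
Proof.
have [->|[r rA]] := set_0Vmem A; first by rewrite tau0.
exact: rcover_bound (rcover_ex rA).
Qed.
End Bound.

(** * Trees of pieces *)

Section Pieces.
Variables (T : finType) (e : rel T).
Implicit Types (A B C D K Q S X Y P : {set T}) (x y z r q : T).

Definition piece X :=
  [\/ exists u v w, P3_on e X u v w,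
      exists l u, cycle_on e X l u /\ l %% 3 != 0 |
      exists l idx u v, spiked_on e X l idx u v /\ very_good_spikes l idx].

(** The construction of [inC] read inside one graph. The contact vertex of the new piece is
    arbitrary, which merges O1 and O2 and makes the joining edge symmetric. *)
Inductive piece_tree : {set T} -> Prop :=
| piece_tree1 X : piece X -> piece_tree X
| piece_treeU A X a z : piece_tree A -> piece X -> [disjoint A & X] ->
    a \in X -> z \in A -> e a z ->
    (forall x y, x \in X -> y \in A -> e x y -> x = a /\ y = z) ->
    piece_tree (A :|: X).

Hypotheses (symE : symmetric e).

(** Pieces are added one at a time, so the second tree is rebuilt onto the first. If the bridge ends
    in the last piece [X], then [X] is attached to [A] first and its old edge [az] becomes the new
    bridge. *)
Lemma piece_tree_bridge A B s t : piece_tree A -> piece_tree B -> [disjoint A & B] ->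
  s \in A -> t \in B -> e s t ->
  (forall x y, x \in A -> y \in B -> e x y -> x = s /\ y = t) ->
  piece_tree (A :|: B).
Proof.
move=> tA tB; elim: tB A s t tA => {B} [X pX|B X a z tB IH pX dBX aX zB az one'] A s t tA.
  move=> dAX sA tX st one; apply: (piece_treeU (a := t) (z := s)) => //.
    by rewrite symE.
  by move=> x y xX yA; rewrite symE => /(one _ _ yA xX)[].
move=> dAB sA tBX st one.
have dA : [disjoint A & B] by apply: disjointWr dAB; apply: subsetUl.
have dX : [disjoint A & X] by apply: disjointWr dAB; apply: subsetUr.
have oneB x y : x \in A -> y \in B -> e x y -> x = s /\ y = t.
  by move=> xA yB; apply: one => //; rewrite inE yB.
have oneX x y : x \in A -> y \in X -> e x y -> x = s /\ y = t.
  by move=> xA yX; apply: one => //; rewrite inE yX orbT.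
have nBX x : x \in B -> x \in X -> False by move=> xB; rewrite (disjointFr dBX).
move: tBX; rewrite inE => /orP[tB'|tX].
  rewrite setUA; apply: (piece_treeU (a := a) (z := z)) => //.
  - exact: IH oneB.
  - by rewrite disjointUs ?dX ?dBX.
  - by rewrite inE zB orbT.
  - move=> x y xX; rewrite inE => /orP[yA|yB]; last exact: one'.
    by rewrite symE => /(oneX _ _ yA xX)[_ E]; case: (nBX t); rewrite // -E.
rewrite [B :|: X]setUC setUA; apply: (IH (A :|: X) a z) => //.
- apply: (piece_treeU (a := t) (z := s)) => //; first by rewrite symE.
  by move=> x y xX yA; rewrite symE => /(oneX _ _ yA xX)[].
- by rewrite disjointUs dA disjoint_sym dBX.
- by rewrite inE aX orbT.
- move=> x y; rewrite inE => /orP[xA|xX] yB; last exact: one'.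
  by move=> /(oneB _ _ xA yB)[_ E]; case: (nBX t); rewrite // -E.
Qed.

(** Components of the rest are absorbed one by one; the others stay components and keep their single
    edge, since they have no edge to the absorbed one. *)
Lemma piece_tree_grow A Q : conn e A -> Q \subset A -> Q != set0 -> piece_tree Q ->
  (forall x, x \in A :\: Q -> piece_tree (component e (A :\: Q) x)) ->
  (forall x, x \in A :\: Q -> one_edge e (component e (A :\: Q) x) Q) ->
  piece_tree A.
Proof.
move=> cA; have [n] := ubnP #|A :\: Q|; elim: n Q => // n IH Q /ltnSE leQ QA Q0 tQ tC oC.
have [E|[x xAQ]] := set_0Vmem (A :\: Q).
  suff -> : A = Q by [].
  by apply/eqP; rewrite eqEsubset QA andbT -setD_eq0 E.
pose K := component e (A :\: Q) x.
have clK : clos e K (A :\: Q) := clos_comp e xAQ.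
have [KAQ _] := clK.
have [s [t [sK tQ' st]]] := conn_edge cA QA Q0 xAQ.
have dKQ : [disjoint K & Q].
  by apply: disjointWl KAQ (disjointDl _ _).
have ED : A :\: (K :|: Q) = (A :\: Q) :\: K by rewrite setUC setDDl.
have clD : clos e ((A :\: Q) :\: K) (A :\: Q) := closD symE clK.
have cE y : y \in A :\: (K :|: Q) -> component e (A :\: (K :|: Q)) y = component e (A :\: Q) y.
  by rewrite ED => yy; rewrite (comp_clos clD yy).
have inQ y : y \in A :\: (K :|: Q) -> y \in A :\: Q.
  by rewrite ED => /setDP[].
apply: (IH (K :|: Q)).
- rewrite ED; apply: leq_trans leQ; apply: proper_card.
  rewrite properEneq subsetDl andbT; apply/eqP => E.
  by move: (xAQ); rewrite -E inE comp_refl.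
- by rewrite subUset QA andbT (subset_trans KAQ) ?subsetDl.
- by apply/set0Pn; exists t; rewrite inE tQ' orbT.
- apply: (piece_tree_bridge (s := s) (t := t)) => //; first exact: tC.
  move=> y z yK zQ yz; exact: (oC x xAQ y z s t).
- by move=> y yy; rewrite cE //; apply: tC; apply: inQ.
- move=> y yy; rewrite cE // => a b a' b' ya ya' bKQ b'KQ ab a'b'.
  have nK c d : c \in component e (A :\: Q) y -> d \in K :|: Q -> e c d -> d \in Q.
    move=> cy; rewrite inE => /orP[dK|//] cd.
    have cD : c \in (A :\: Q) :\: K.
      move: yy cy; rewrite ED => yy; rewrite -(comp_clos clD yy).
      by apply: (subsetP (comp_sub e yy)).
    have := clos_notin clD cD (subsetP KAQ _ dK); rewrite inE dK cd => /(_ isT).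
    by [].
  by apply: (oC y (inQ _ yy)); rewrite ?(nK a b) ?(nK a' b').
Qed.

Hypotheses (irrE : irreflexive e) (cdE : cycle_disjoint e).
Local Notation w := (weight e).
Local Notation cyc := (cyc e).
Local Notation tau := (tau e).
Local Notation component := (component e).

Lemma tau_rem_clos A y K : clos e K (A :\ y) ->
  3 * tau A <= 3 + 3 * tau K + 3 * tau ((A :\ y) :\: K).
Proof.
move=> clK; have := tau_rem e A [set y]; have := tau_clos symE clK.
rewrite cards1; clear; lia.
Qed.

(* C is the core of a piece, P the set of its spikes (for a tree, C is the centre
   of a P_3 and P its two ends).  A hanging part of residue 1 becomes tight once its
   spike p is deleted: the rest of A then has residue 2, which uses up the slack. *)
Lemma piece_tree_core A C P :
  conn e A -> C \subset A -> C != set0 -> 3 * tau A = w A ->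
  (forall x x' u u', x \in A :\: C -> x' \in component (A :\: C) x -> u \in C -> u' \in C ->
     e x u -> e x' u' -> x = x' /\ u = u') ->
  P \subset A :\: C ->
  (forall p, p \in P -> (exists2 u, u \in C & e p u) /\ w (component (A :\: C) p) %% 3 = 1) ->
  (forall x, x \in A :\: C -> [disjoint component (A :\: C) x & P] ->
     3 * tau (component (A :\: C) x) = w (component (A :\: C) x)) ->
  (forall B, B \proper A -> conn e B -> B != set0 -> 3 * tau B = w B -> piece_tree B) ->
  piece_tree (C :|: P) -> piece_tree A.
Proof.
move=> cA CA C0 tA h1 PA hP hN IH tQ.
have C0' := C0; case/set0Pn: C0' => c cC.
have QA : C :|: P \subset A by rewrite subUset CA (subset_trans PA) ?subsetDl.
have inC x : x \in A :\: (C :|: P) -> x \in A :\: C.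
  by rewrite -setDDl => /setDP[].
have key x : x \in A :\: (C :|: P) -> piece_tree (component (A :\: (C :|: P)) x) /\
    one_edge e (component (A :\: (C :|: P)) x) (C :|: P).
  move=> xAQ; have xAC := inC _ xAQ.
  pose K0 := component (A :\: C) x.
  have clK0 : clos e K0 (A :\: C) := clos_comp e xAC; have [K0A _] := clK0.
  have h1' a a' u u' : a \in K0 -> a' \in K0 -> u \in C -> u' \in C ->
      e a u -> e a' u' -> a = a' /\ u = u'.
    move=> aK a'K; apply: h1; first exact: (subsetP K0A).
    by rewrite (comp_eq symE aK).
  have [dK|] := boolP [disjoint K0 & P].
    have EK : component (A :\: (C :|: P)) x = K0.
      rewrite -(@comp_clos _ _ K0) ?comp_refl //; first exact: comp_clos clK0 (comp_refl _ _ _).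
      apply: (clos_sub clK0); last by rewrite -setDDl subsetDl.
      apply/subsetP => y yK; rewrite -setDDl inE (subsetP K0A) // andbT.
      by rewrite (disjointFr dK).
    rewrite EK; split.
      apply: IH => //; last exact: hN.
      - rewrite properE (subset_trans K0A) ?subsetDl //=; apply/subsetPn; exists c.
          exact: (subsetP CA).
        by apply/negP => /(subsetP K0A); rewrite inE cC.
      - exact: conn_comp.
      - by apply/set0Pn; exists x; apply: comp_refl.
    move=> a b a' b' aK a'K bQ b'Q ab a'b'.
    have nP d f : d \in K0 -> f \in C :|: P -> e d f -> f \in C.
      move=> dK0; rewrite inE => /orP[//|fP] df.
      have := clos_notin clK0 dK0 (subsetP PA _ fP); rewrite (disjointFl dK fP) df.
      by move=> /(_ isT).
    exact: h1' (nP a b aK bQ ab) (nP a' b' a'K b'Q a'b') ab a'b'.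
  rewrite -setI_eq0 => /set0Pn[p /setIP[pK pP]].
  have [[u uC pu] w1] := hP p pP.
  have Ep : component (A :\: C) p = K0 := comp_eq symE pK.
  rewrite Ep in w1.
  pose K := component (A :\: (C :|: P)) x; rewrite -/K.
  have [KAQ clK] : clos e K (A :\: (C :|: P)) := clos_comp e xAQ.
  have pA : p \in A by have := subsetP PA _ pP; rewrite inE => /andP[].
  have KK0 : K \subset K0.
    apply/subsetP => y; apply: comp_closed (comp_refl _ _ _) => a b aK bA ab.
    by apply: comp_step ab => //; apply: inC.
  have notQ y : y \in K -> y \notin C /\ y \notin P.
    by move=> /(subsetP KAQ); rewrite !inE negb_or => /andP[/andP[-> ->]].
  have pKn : p \notin K by apply/negP => /notQ[_]; rewrite pP.
  have KA : K \subset A by apply: subset_trans KAQ (subsetDl _ _).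
  have clKp : clos e K (A :\ p).
    split.
      by apply/subsetP => y yK; rewrite !inE (subsetP KA) // andbT; apply: contra pKn => /eqP <-.
    move=> a b aK /setD1P[bp bA] ab.
    have aK0 := subsetP KK0 _ aK.
    have [bC|bC] := boolP (b \in C).
      by have [E _] := h1' _ _ _ _ aK0 pK bC uC ab pu; rewrite E (negPf pKn) in aK.
    have [bP|bP] := boolP (b \in P); last by apply: clK aK _ ab; rewrite !inE negb_or bC bP.
    have bK0 : b \in K0 by case: clK0 => _; apply; [exact: aK0| rewrite inE bC | ].
    have [[v vC bv] _] := hP b bP.
    by have [E _] := h1' _ _ _ _ bK0 pK vC uC bv pu; rewrite E eqxx in bp.
  have K0sub : K0 \subset A by apply: subset_trans K0A (subsetDl _ _).
  have toC a b : a \in K0 -> b \in A :\: K0 -> e a b -> b \in C.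
    move=> aK /setDP[bA bK] ab; apply: contraR bK => bC.
    by case: clK0 => _; apply; [exact: aK| rewrite inE bC | ].
  have clR : clos e (A :\: K0) (A :\ p).
    split.
      by apply/subsetP => y /setDP[yA yK]; rewrite !inE yA andbT; apply: contra yK => /eqP->.
    move=> a b aR /setD1P[bp bA] ab; rewrite in_setD bA andbT.
    apply: contra bp => bK; have aC : a \in C by apply: toC bK aR _; rewrite symE.
    by rewrite symE in ab; have [-> _] := h1' _ _ _ _ bK pK aC uC ab pu.
  have dKK : [disjoint K0 & A :\: K0].
    by rewrite disjoint_sym disjointDl.
  have wE : w A = w K0 + w (A :\: K0).
    rewrite -(weight_split symE) //; first by rewrite setUC setDUK.
    move=> a b a' b' aK a'K bR b'R ab a'b'; apply: h1' => //; exact: toC ab || exact: toC a'b'.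
  have clR' : clos e (A :\: K0) ((A :\ p) :\: K).
    apply: (clos_sub clR); last exact: subsetDl.
    apply/subsetP => y yR; rewrite inE (subsetP (proj1 clR) _ yR) andbT.
    by case/setDP: yR => _; apply: contra; apply: (subsetP KK0).
  have t1 := tau_rem_clos clKp.
  have t2 := tau_clos symE clR'.
  have t3 := tau_bound symE irrE cdE (A :\: K0).
  have t4 := tau_bound symE irrE cdE (((A :\ p) :\: K) :\: (A :\: K0)).
  have t5 := tau_bound symE irrE cdE K.
  have w2 := weight_clos symE clKp.
  have w3 := weight_clos symE clR'.
  (* [A :\: K0] has residue 2, hence slack at least 2, and deleting [p] then gives
     [w A <= 1 + w (A :\ p)]. A cycle through [p] would make the drop at least 2. *)
  have nocyc S : cyc S -> S \subset A -> p \notin S.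
    move=> cS SA; apply/negP => pS.
    have := weight_remC cdE cS SA (X := [set p]); rewrite sub1set => /(_ pS).
    rewrite cards1 /cyc_weight => H; have {}H := H ltac:(by apply/set0Pn; exists p; rewrite set11).
    by move: t1 t2 t3 t4 t5 w2 w3 H tA wE w1; clear; lia.
  have wA : w A = 1 + w (A :\ p).
    rewrite (weight_rem (X := [set p])) ?cards1 ?sub1set // => S cS SA.
    by rewrite disjoint_sym disjoints1 nocyc.
  split.
    (* Now [w A = 1 + w (A :\ p)], so all inequalities of that chain are equalities and [K] is
       tight. *)
    apply: IH; last by move: t1 t2 t3 t4 t5 w2 w3 wA tA wE w1; clear; lia.
    - rewrite properE KA; apply/subsetPn; exists p => //.
    - exact: conn_comp.
    - by apply/set0Pn; exists x; apply: comp_refl.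
  have toP a b : a \in K -> b \in C :|: P -> e a b -> b = p.
    move=> aK bQ ab; apply/eqP; apply: contraT => bp.
    have bAp : b \in A :\ p by rewrite in_setD1 bp (subsetP QA).
    have [bC bP] := notQ _ (proj2 clKp a b aK bAp ab).
    by move: bQ; rewrite in_setU (negPf bC) (negPf bP).
  move=> a b a' b' aK a'K bQ b'Q ab a'b'.
  have Eb := toP _ _ aK bQ ab; have Eb' := toP _ _ a'K b'Q a'b'.
  split; last by rewrite Eb Eb'.
  subst b b'; apply/eqP; apply: contraT => na.
  (* A second edge from [K] to [p] would close a cycle through [p]. *)
  have [] := cyc_nbrs symE pKn aK _ na (etrans (symE _ _) ab) (etrans (symE _ _) a'b').
    exact: (conn_comp symE xAQ).
  move=> S [cS pS _ _ SA]; have := nocyc S cS; rewrite pS; apply.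
  by apply: subset_trans SA _; rewrite subUset sub1set pA.
apply: (piece_tree_grow cA QA) => //.
- by apply/set0Pn; exists c; rewrite inE cC.
- by move=> x /key[].
- by move=> x /key[].
Qed.

Lemma comps_mod B : (forall x, x \in B -> w (component B x) %% 3 = 0) -> w B %% 3 = 0.
Proof.
have [n] := ubnP #|B|; elim: n B => // n IH B /ltnSE leB H.
have [->|[x xB]] := set_0Vmem B.
  rewrite /weight cards0 big1 // => S; rewrite subset0 => /andP[/cyc_card cS /eqP E].
  by rewrite E cards0 in cS.
have clx := clos_comp e xB; have clD := closD symE clx.
rewrite (weight_clos symE clx) -modnDm H // IH //.
  apply: leq_trans leB; apply: proper_card; rewrite properEneq subsetDl andbT.
  by apply/eqP => E; move: (xB); rewrite -E inE comp_refl.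
by move=> y yD; rewrite (comp_clos clD yD) H //; case/setDP: yD.
Qed.

Lemma comps_mod_ex B : w B %% 3 <> 0 -> exists2 x, x \in B & w (component B x) %% 3 != 0.
Proof.
move=> wB; have [/existsP[x /andP[xB ?]]|nex] := boolP [exists x, (x \in B) && (w (component B x) %% 3 != 0)].
  by exists x.
case: wB; apply: comps_mod => x xB; apply/eqP; apply: contraR nex => nx.
by apply/existsP; exists x; rewrite xB.
Qed.

End Pieces.

(** * Tight trees *)

Section TightTree.
Variables (T : finType) (e : rel T).
Hypotheses (symE : symmetric e) (irrE : irreflexive e) (cdE : cycle_disjoint e).
Implicit Types (A B C D K Q S X Y P : {set T}) (x y z r q v : T).
Local Notation w := (weight e).
Local Notation cyc := (cyc e).
Local Notation tau := (tau e).
Local Notation component := (component e).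
Local Notation clos := (clos e).

Lemma comp_disjoint B x y : y \notin component B x ->
  [disjoint component B x & component B y].
Proof.
apply: contraR; rewrite -setI_eq0 => /set0Pn[z /setIP[zx zy]].
by rewrite -(comp_eq symE zx) (comp_eq symE zy) comp_refl.
Qed.

Lemma weight0 : w set0 = 0.
Proof.
rewrite /weight cards0 big1 // => S; rewrite subset0 => /andP[/cyc_card cS /eqP E].
by rewrite E cards0 in cS.
Qed.

Lemma clos0 A : clos set0 A.
Proof. by split; [apply: sub0set | move=> a b; rewrite inE]. Qed.

(** [m] is the weight of the remainder, whose tau is an integer and so at most [m %/ 3]. Three parts
    suffice for all applications; shorter families are padded with [set0]. *)
Lemma three_clos B K1 K2 K3 : clos K1 B -> clos K2 B -> clos K3 B ->
  [disjoint K1 & K2] -> [disjoint K1 & K3] -> [disjoint K2 & K3] ->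
  exists m, tau B <= tau K1 + tau K2 + tau K3 + m %/ 3 /\ w B = w K1 + w K2 + w K3 + m.
Proof.
move=> c1 c2 c3 d12 d13 d23; exists (w (((B :\: K1) :\: K2) :\: K3)).
have c2' : clos K2 (B :\: K1).
  by apply: (clos_sub c2); rewrite ?subsetDl // subsetD disjoint_sym d12 andbT; case: c2.
have c3' : clos K3 ((B :\: K1) :\: K2).
  apply: (clos_sub c3); last by rewrite setDDl subsetDl.
  by rewrite !subsetD ![[disjoint K3 & _]]disjoint_sym d13 d23 !andbT; case: c3.
have b := tau_bound symE irrE cdE (((B :\: K1) :\: K2) :\: K3).
have := tau_clos symE c1; have := tau_clos symE c2'; have := tau_clos symE c3'.
have := weight_clos symE c1; have := weight_clos symE c2'; have := weight_clos symE c3'.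
by move: b; clear; lia.
Qed.

Lemma floor_bound A : tau A <= w A %/ 3.
Proof. by have := tau_bound symE irrE cdE A; clear; lia. Qed.

Lemma tau_rem1 A y : tau A <= 1 + tau (A :\ y).
Proof. by have := tau_rem e A [set y]; rewrite cards1. Qed.

Lemma weight_rem1 A v : v \in A -> (forall S, cyc S -> S \subset A -> v \notin S) ->
  w A = 1 + w (A :\ v).
Proof.
move=> vA nS; rewrite (weight_rem (X := [set v])) ?cards1 ?sub1set // => S cS SA.
by rewrite disjoint_sym disjoints1 nS.
Qed.

Section Tree.
Variable A : {set T}.
Hypotheses (cA : conn e A) (tA : 3 * tau A = w A).
Hypothesis acyc : forall S, cyc S -> ~~ (S \subset A).

Lemma tree_one v x x' : x \in A :\ v -> x' \in component (A :\ v) x ->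
  v \in A -> e x v -> e x' v -> x = x'.
Proof.
move=> xA xx' vA xv x'v; apply/eqP; apply: contraT => nx.
have vv : v \notin A :\ v by rewrite !inE eqxx.
have [S [cS _ _ _ SA]] :=
  cyc_nbrs symE vv xA xx' nx (etrans (symE _ _) xv) (etrans (symE _ _) x'v).
by rewrite setD1K // (negPf (acyc cS)) in SA.
Qed.

Lemma tree_w v : v \in A -> w A = 1 + w (A :\ v).
Proof.
by move=> vA; apply: weight_rem1 => // S cS SA; rewrite (negPf (acyc cS)) in SA.
Qed.

(** Deleting [v] costs 3 and lowers the weight by 1, so the parts of [A :\ v] have total slack at
    most 2. The exact slack is kept for [K1], and only its lower bound, the residue, for the
    others. *)
Lemma tree_mod v K1 K2 K3 : v \in A -> clos K1 (A :\ v) -> clos K2 (A :\ v) ->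
  clos K3 (A :\ v) ->
  [disjoint K1 & K2] -> [disjoint K1 & K3] -> [disjoint K2 & K3] ->
  w K1 + w K2 %% 3 + w K3 %% 3 <= 3 * tau K1 + 2 /\ w (A :\ v) %% 3 = 2.
Proof.
move=> vA c1 c2 c3 d12 d13 d23; have [m [b1 b2]] := three_clos c1 c2 c3 d12 d13 d23.
have := tau_rem1 A v; have := tree_w vA; have := floor_bound K2; have := floor_bound K3.
by move: b1 b2 tA; clear; lia.
Qed.

Lemma tree_mod2 v K1 K2 : v \in A -> clos K1 (A :\ v) -> clos K2 (A :\ v) ->
  [disjoint K1 & K2] -> w K1 %% 3 + w K2 %% 3 <= 2.
Proof.
move=> vA c1 c2 d12.
have [] := tree_mod vA (clos0 _) c1 c2 _ _ d12; rewrite -?setI_eq0 ?set0I //.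
by rewrite weight0 tau0; clear; lia.
Qed.

Lemma tree_nbr v x : v \in A -> x \in A :\ v ->
  exists q, [/\ q \in A :\ v, e v q & component (A :\ v) q = component (A :\ v) x].
Proof.
move=> vA xA.
have [q [z [qx zv qz]]] := conn_edge cA (Q := [set v]) ltac:(by rewrite sub1set)
  ltac:(by apply/set0Pn; exists v; rewrite set11) xA.
exists q; split; [exact: (subsetP (comp_sub e xA))| | exact: comp_eq].
by rewrite symE; move/set1P: zv => <-.
Qed.

(* The residues around any vertex v sum to 2.  If they are not 1 + 1, move to the
   neighbour of v in the part of residue 2. *)
Lemma tree_center : A != set0 -> exists v q1 q2,
  [/\ v \in A, q1 \in A :\ v, q2 \in A :\ v & [/\ e v q1, e v q2,
      q2 \notin component (A :\ v) q1,
      w (component (A :\ v) q1) %% 3 = 1 & w (component (A :\ v) q2) %% 3 = 1]].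
Proof.
move=> /set0Pn[v vA].
(* One part of residue 1 is enough: the total residue is 2, so another part has nonzero residue, and
   the two sum to at most 2. *)
have second v1 x1 : v1 \in A -> x1 \in A :\ v1 -> w (component (A :\ v1) x1) %% 3 = 1 ->
    exists v q1 q2,
  [/\ v \in A, q1 \in A :\ v, q2 \in A :\ v & [/\ e v q1, e v q2,
      q2 \notin component (A :\ v) q1,
      w (component (A :\ v) q1) %% 3 = 1 & w (component (A :\ v) q2) %% 3 = 1]].
  move=> v1A x1A w1; have cl1 := clos_comp e x1A; have clD := closD symE cl1.
  have [_ w2] := tree_mod v1A (clos0 _) (clos0 _) (clos0 _)
    ltac:(by rewrite -setI_eq0 set0I) ltac:(by rewrite -setI_eq0 set0I)
    ltac:(by rewrite -setI_eq0 set0I).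
  have [|x2 x2D] := @comps_mod_ex _ e symE (A :\ v1 :\: component (A :\ v1) x1).
    by have := weight_clos symE cl1; move: w1 w2; clear; lia.
  rewrite (comp_clos clD x2D) => w3; have /setDP[x2A x2n] := x2D.
  have := tree_mod2 v1A cl1 (clos_comp e x2A) (comp_disjoint x2n).
  have [q1 [q1A vq1 E1]] := tree_nbr v1A x1A.
  have [q2 [q2A vq2 E2]] := tree_nbr v1A x2A.
  move=> w4; exists v1, q1, q2; rewrite E1 E2 w1; split=> //; split=> //.
    apply: contra x2n => q2x; rewrite -(comp_eq symE q2x) E2.
    exact: comp_refl.
  by move: w3 w4; rewrite w1; clear; lia.
have [_ w2] := tree_mod vA (clos0 _) (clos0 _) (clos0 _)
    ltac:(by rewrite -setI_eq0 set0I) ltac:(by rewrite -setI_eq0 set0I)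
    ltac:(by rewrite -setI_eq0 set0I).
have [|x xA wx] := @comps_mod_ex _ e symE (A :\ v); first by rewrite w2.
have [q [qA vq E]] := tree_nbr vA xA; rewrite -E in wx.
have [w1|w1] := eqVneq (w (component (A :\ v) q) %% 3) 1; first exact: second qA w1.
have {w1}wx : w (component (A :\ v) q) %% 3 = 2 by move: wx w1; clear; lia.
set K := component (A :\ v) q in wx.
have /setD1P[nqv qA'] := qA.
have vq' : v \in A :\ q by rewrite !inE vA eq_sym nqv.
have [KA clK] : clos K (A :\ v) := clos_comp e qA.
have qK : q \in K := comp_refl _ _ _.
have vK : v \notin K by apply/negP => /(subsetP KA); rewrite !inE eqxx.
have edge a b : a \in A -> a \notin K -> b \in K -> e a b -> a = v /\ b = q.
  move=> aA aK bK ab; have Ea : a = v.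
    apply/eqP; apply: contraR aK => av; apply: clK bK _ _; last by rewrite symE.
    by rewrite in_setD1 av.
  split=> //; apply/esym; apply: (@tree_one v q b) => //; first by rewrite symE.
  by rewrite symE -Ea.
have clAK : clos (A :\: K) (A :\ q).
  split.
    by apply/subsetP => y /setDP[yA yK]; rewrite in_setD1 yA andbT; apply: contra yK => /eqP->.
  move=> a b /setDP[aA aK] /setD1P[bq bA] ab; rewrite in_setD bA andbT.
  by apply: contra bq => bK; have [_ ->] := edge _ _ aA aK bK ab.
have EK : component (A :\ q) v = A :\: K.
  apply/eqP; rewrite eqEsubset; apply/andP; split.
    by rewrite -(comp_clos clAK) ?comp_sub // in_setD vK.
  apply/subsetP => y yAK; have yq : y \in A :\ q by apply: (subsetP (proj1 clAK)).
  have [s [sA qs Es]] := tree_nbr qA' yq.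
  have sy : s \in component (A :\ q) y by rewrite -Es comp_refl.
  have sK : s \in A :\: K.
    by move: sy; rewrite -(comp_clos clAK yAK) => /(subsetP (comp_sub e yAK)).
  have /setDP[sA' sK'] := sK; rewrite symE in qs.
  by have [<- _] := edge _ _ sA' sK' qK qs; rewrite Es comp_refl.
(* Weights add over the edge [vq], so the side of [v] has residue 0 - 2, that is 1 modulo 3. *)
apply: (second q v) => //; rewrite EK.
have KA' : K \subset A by apply: subset_trans KA (subsetDl _ _).
have := weight_split symE (disjointDl A K); rewrite setDUK // => H.
have := tree_w vA; have := tree_w qA'.
suff /H : one_edge e (A :\: K) K by move: wx w2; clear; lia.
move=> a b a' b' /setDP[aA aK] /setDP[a'A a'K] bK b'K ab a'b'.
by have [-> ->] := edge _ _ aA aK bK ab; have [-> ->] := edge _ _ a'A a'K b'K a'b'.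
Qed.

(** The centre and its two chosen neighbours form the P_3. Their parts use up the slack 2 around
    [v], so every other part at [v] is tight. *)
Lemma tight_tree : A != set0 ->
  (forall B, B \proper A -> conn e B -> B != set0 -> 3 * tau B = w B -> piece_tree e B) ->
  piece_tree e A.
Proof.
move=> A0 IH; have [v [q1 [q2 [vA q1A q2A [vq1 vq2 nq w1 w2]]]]] := tree_center A0.
apply: (@piece_tree_core _ _ symE irrE cdE A [set v] [set q1; q2]) => //.
- by rewrite sub1set.
- by apply/set0Pn; exists v; rewrite set11.
- move=> x x' u u' xA xx' /set1P-> /set1P-> xv x'v; split=> //.
  exact: tree_one xx' vA xv x'v.
- by rewrite subUset !sub1set q1A.
- by move=> p /set2P[]->; split=> //; exists v; rewrite ?set11 // symE.
- move=> x xA dx; apply/eqP; rewrite eqn_leq (tau_bound symE irrE cdE) /=.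
  have nx q : q \in [set q1; q2] -> q \notin component (A :\ v) x.
    by move=> qq; rewrite (disjointFl dx).
  have [] := tree_mod vA (clos_comp e xA) (clos_comp e q1A) (clos_comp e q2A).
  + by apply: comp_disjoint; apply: nx; rewrite set21.
  + by apply: comp_disjoint; apply: nx; rewrite set22.
  + exact: comp_disjoint.
  by rewrite w1 w2; clear; lia.
apply: piece_tree1; apply: Or31; exists q1, v, q2.
have /setD1P[q1v q1A'] := q1A; have /setD1P[q2v q2A'] := q2A.
have nqe : e q1 q2 = false by apply: clos_notin (clos_comp e q1A) (comp_refl _ _ _) q2A nq.
split; [ | done | by rewrite eq_sym | | ].
- by apply/setP => z; rewrite !inE; do 3!case: eqP.
- by apply: contra nq => /eqP->; apply: comp_refl.
move=> x y; rewrite !inE => Hx Hy; split; last first.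
  by case=> -[-> ->]; rewrite // symE.
case/or3P: Hx => /eqP->; case/or3P: Hy => /eqP->; rewrite ?irrE ?nqe //.
all: move=> E; first [by rewrite symE nqe in E | by apply: Or41 | by apply: Or42
                     | by apply: Or43 | by apply: Or44].
Qed.

End Tree.
End TightTree.

(** * Residues along a spiked cycle *)

Section SpikeWords.
Variables (T : eqType) (S : pred T).
Implicit Types (p q r : seq T).

(** Bookkeeping modulo 3 for an arc of the cycle: each vertex counts 1, and each spiked vertex (in
    [S]) carries hanging parts of total residue 1. *)
Definition word_weight p := size p + count S p.

Lemma word_weight_cat p q : word_weight (p ++ q) = word_weight p + word_weight q.
Proof. by rewrite /word_weight size_cat count_cat addnACA. Qed.

Lemma word_weight_cons x p : S x -> word_weight (x :: p) = 2 + word_weight p.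
Proof. by rewrite /word_weight /= => ->; lia. Qed.

(* Between two spikes the word weight is 0 or 1 mod 3.  Started at a spike, these
   weights are 1, ..., 1, 0, ..., 0; restarting at the first 0 makes all of them 1,
   which is the gap condition of a good spiked cycle. *)
Lemma rotate_spikes (R : seq T -> Prop) p :
  (forall a b, R (a ++ b) -> R (b ++ a)) ->
  (forall q, R q -> word_weight q %% 3 = 2) ->
  (forall s p1 s' p2, R (s :: p1 ++ s' :: p2) -> S s -> S s' -> word_weight p1 %% 3 <= 1) ->
  R p -> has S p ->
  exists s r, [/\ R (s :: r), S s &
    forall k, k < size (s :: r) -> S (nth s (s :: r) k) ->
      word_weight (take k (s :: r)) %% 3 = 0].
Proof.
move=> Rrot R2 Rle Rp /hasP[s sp Ss].
have [r Rr] : exists r, R (s :: r).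
  case/splitPr: sp Rp => p1 p2 /Rrot; rewrite cat_cons => H; by exists (p2 ++ p1).
have le1 s1 r1 k : R (s1 :: r1) -> S s1 -> k < size r1 -> S (nth s r1 k) ->
    word_weight (take k r1) %% 3 <= 1.
  move=> Rr1 Ss1 kr Sk; apply: (Rle s1 _ (nth s r1 k) (drop k.+1 r1)) => //.
  by rewrite -drop_nth // cat_take_drop.
suff [s1 [r1 [Rr1 Ss1 H]]] : exists s1 r1, [/\ R (s1 :: r1), S s1 &
    forall k, k < size r1 -> S (nth s r1 k) -> word_weight (take k r1) %% 3 = 1].
  exists s1, r1; split=> // -[|k] //= ltk Sk.
  rewrite word_weight_cons //; have := H k ltk; rewrite (set_nth_default s1) //.
  by move=> /(_ Sk); clear; lia.
pose bad k := [&& k < size r, S (nth s r k) & word_weight (take k r) %% 3 != 1].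
have [[k0 bk0]|nbad] : (exists k, bad k) \/ (forall k, ~~ bad k).
  have [/hasP[k _ bk]|/hasPn nb] := boolP (has bad (iota 0 (size r))); first by left; exists k.
  right=> k; have [kr|kr] := ltnP k (size r); first by apply: nb; rewrite mem_iota.
  by rewrite /bad ltnNge kr.
  (* The first spike whose arc from [s] has residue 0; the cycle is restarted there. *)
  have [k /and3P[kr Sk wk] kmin] := ex_minnP (ex_intro _ k0 bk0).
  set a := take k r; set b := drop k.+1 r; set t := nth s r k.
  have Er : r = a ++ t :: b by rewrite /a /t /b -drop_nth // cat_take_drop.
  have wa : word_weight a %% 3 = 0.
    by have := le1 s r k Rr Ss kr Sk; move: wk; rewrite -/a; clear; lia.
  have Rt : R (t :: b ++ s :: a).
    by rewrite -cat_cons; apply: Rrot; rewrite cat_cons -Er.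
  exists t, (b ++ s :: a); split=> // j ltj Sj.
  have szr : size r = size a + (size b).+1 by rewrite Er size_cat.
  have sza : size a = k by rewrite size_takel // ltnW.
  rewrite size_cat /= in ltj.
  (* For a spike after [t], the arc from [t] has residue x and the arc from [s] has residue 2 + x;
     both are at most 1 modulo 3, so x is 1. For [s] itself the total residue 2 decides. For a spike
     before [t], minimality of [k] gives residue 1 from [s]. *)
  have [jb|jb] := ltnP j (size b).
    have E1 : nth s (b ++ s :: a) j = nth s r (k + j.+1).
      by rewrite nth_cat jb Er nth_cat sza ltnNge leq_addr addKn.
    have E2 : take j (b ++ s :: a) = take j b by rewrite takel_cat // ltnW.
    have E3 : take (k + j.+1) r = a ++ t :: take j b.
      by rewrite Er take_cat sza ltnNge leq_addr addKn.
    have := le1 t (b ++ s :: a) j Rt Sk; rewrite size_cat /= ltj => /(_ isT Sj).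
    have := le1 s r (k + j.+1) Rr Ss; rewrite szr sza ltn_add2l ltnS jb -E1 => /(_ isT Sj).
    rewrite E2 E3 word_weight_cat word_weight_cons //; move: wa; clear; lia.
  have wt := R2 _ Rr; rewrite Er word_weight_cons // word_weight_cat word_weight_cons // in wt.
  have [Ej|nj] := eqVneq j (size b).
    by rewrite Ej take_size_cat //; move: wt wa; clear; lia.
  have [i Ei] : exists i, j = (size b) + i.+1 by exists (j - size b).-1; move: jb nj; clear; lia.
  have ik : i < k by move: ltj; rewrite Ei sza; clear; lia.
  have E4 : take j (b ++ s :: a) = b ++ s :: take i a.
    by rewrite Ei take_cat ltnNge leq_addr addKn.
  have E5 : nth s (b ++ s :: a) j = nth s a i by rewrite Ei nth_cat ltnNge leq_addr addKn.
  have E6 : take i a = take i r by rewrite /a take_takel // ltnW.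
  have E7 : nth s a i = nth s r i by rewrite /a nth_take.
  rewrite E4 word_weight_cat word_weight_cons // E6.
  have : ~~ bad i by apply/negP => /kmin; rewrite leqNgt ik.
  rewrite /bad (ltn_trans ik kr) -E7 -E5 Sj /= negbK => /eqP.
  move: wt wa; clear; lia.
exists s, r; split=> // k kr Sk; have := nbad k; rewrite /bad kr Sk /= negbK => /eqP //.
Qed.

Definition spike_idx (b : pred nat) l := [seq i <- iota 1 l | b i].

Lemma spike_idx_mem b l i : i \in spike_idx b l = b i && (0 < i <= l).
Proof. by rewrite mem_filter mem_iota add1n ltnS. Qed.

Lemma spike_idx_nth b l j : j < size (spike_idx b l) ->
  count b (iota 1 (nth 0 (spike_idx b l) j).-1) = j.
Proof.
move=> jl; set i := nth 0 _ j.
have uI : uniq (spike_idx b l) by rewrite filter_uniq ?iota_uniq.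
have : i \in spike_idx b l by apply: mem_nth.
rewrite spike_idx_mem => /and3P[bi i0 il].
have := index_uniq 0 jl uI; rewrite -/i /spike_idx.
have -> : l = i.-1 + (l - i).+1 by lia.
rewrite iotaD filter_cat /= add1n prednK // bi index_cat mem_filter mem_iota.
rewrite add1n prednK // ltnn !andbF /= eqxx addn0 -size_filter => <- //.
Qed.

(** Spike number j (from 0) at position i has i - 1 vertices and j spikes before it, so i - 1 + j is
    0 modulo 3. Differences give the gaps, and the total residue 2 gives the wrap-around gap. A
    single spike would force length 1 modulo 3. *)
Lemma very_good_spikes_word s r (q := s :: r) :
  (forall k, k < size q -> S (nth s q k) -> word_weight (take k q) %% 3 = 0) ->
  S s -> word_weight q %% 3 = 2 -> size q %% 3 <> 1 ->
  very_good_spikes (size q) (spike_idx (fun i => S (nth s q i.-1)) (size q)).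
Proof.
move=> H Ss wq lq; set b := fun i => _; set l := size q; set idx := spike_idx b l.
have cb k : k <= l -> count b (iota 1 k) = count S (take k q).
  move=> kl; have -> : take k q = [seq nth s q i.-1 | i <- iota 1 k].
    apply: (@eq_from_nth _ s); first by rewrite size_map size_iota size_takel.
    move=> i; rewrite size_takel // => ik; rewrite nth_take //.
    by rewrite (nth_map 0) ?size_iota // nth_iota.
  by rewrite count_map.
have nI j : j < size idx ->
    [/\ 0 < nth 0 idx j, nth 0 idx j <= l & ((nth 0 idx j).-1 + j) %% 3 = 0].
  move=> jl; have : nth 0 idx j \in idx by apply: mem_nth.
  rewrite spike_idx_mem => /and3P[bj j0 jle]; split=> //.
  have := H (nth 0 idx j).-1; rewrite /word_weight size_takel; last by move: jle; rewrite /l; clear; lia.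
  rewrite -cb; last by move: jle; clear; lia.
  rewrite spike_idx_nth //; apply => //; rewrite prednK //.
have szI : size idx = count S q by rewrite size_filter cb // take_size.
have sorted_idx : sorted ltn idx.
  by apply: sorted_filter; [apply: ltn_trans | apply: iota_ltn_sorted].
have s0 : 0 < size idx by rewrite szI /= Ss.
have wq' : (l + size idx) %% 3 = 2 by rewrite szI.
have s1 : 1 < size idx.
  by move: wq' lq s0; rewrite -/l; clear; lia.
rewrite /very_good_spikes; apply/andP; split; last by apply/eqP.
apply/orP; right; apply/and3P; split=> //.
  apply/allP => j; rewrite mem_iota add0n => /andP[_ jl].
  have jl' : j.+1 < size idx by move: jl s0; clear; lia.
  have [a1 a2 a3] := nI j (ltnW jl'); have [b1 b2 b3] := nI j.+1 jl'.
  have ltj : nth 0 idx j < nth 0 idx j.+1.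
    by apply: (sorted_ltn_nth ltn_trans 0 sorted_idx) => //; rewrite inE ltnW.
  by move: a1 a2 a3 b1 b2 b3 ltj; clear; lia.
rewrite -nth0 -nth_last.
have [a1 a2 a3] := nI 0 s0.
have [|b1 b2 b3] := nI (size idx).-1; first by rewrite prednK.
by move: a1 a2 a3 b1 b2 b3 wq' s0; clear; lia.
Qed.
End SpikeWords.

(** * Tight graphs with a cycle *)

Section NextMod.
Variable T : eqType.
Lemma next_mod (s : T) q k : uniq q -> k < size q ->
  next q (nth s q k) = nth s q (k.+1 %% size q).
Proof.
case: q => // y q uq kq; rewrite next_nth mem_nth // index_uniq //.
have [->|nk] := eqVneq k (size q); first by rewrite modnn nth_default.
have kq' : k < size q by move: kq nk => /=; clear; lia.
by rewrite modn_small //= (set_nth_default s).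
Qed.
End NextMod.

Section TightCycle.
Variables (T : finType) (e : rel T).
Hypotheses (symE : symmetric e) (irrE : irreflexive e) (cdE : cycle_disjoint e).
Implicit Types (A B C D K Q S X Y P : {set T}) (x y z r u : T).
Local Notation w := (weight e).
Local Notation cyc := (cyc e).
Local Notation tau := (tau e).
Local Notation component := (component e).
Local Notation clos := (clos e).

(** The unreduced index [.+1.-1] is what [cycle_on] produces for the 1-based enumeration
    [fun i => nth s q i.-1]. *)
Lemma cycle_edges s q x y : is_cycle e q -> x \in q -> y \in q ->
  (e x y <-> exists2 i, 0 < i <= size q &
     (x = nth s q i.-1 /\ y = nth s q (i %% size q).+1.-1) \/
     (y = nth s q i.-1 /\ x = nth s q (i %% size q).+1.-1)).
Proof.
move=> cq xq yq; have /and3P[uq _ cy] := cq.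
have nx z : z \in q -> exists2 i, 0 < i <= size q &
    z = nth s q i.-1 /\ next q z = nth s q (i %% size q).+1.-1.
  move=> zq; exists (index z q).+1; first by rewrite index_mem.
  rewrite /= nth_index //; split=> //.
  by rewrite -{1}(nth_index s zq) next_mod ?index_mem.
have ex i : 0 < i <= size q -> e (nth s q i.-1) (nth s q (i %% size q).+1.-1).
  move=> /andP[i0 il] /=; have lti : i.-1 < size q by move: i0 il; clear; lia.
  have := next_cycle cy (mem_nth s lti).
  by rewrite next_mod // prednK.
split=> [xy|[i il [[-> ->]|[-> ->]]]]; [|exact: ex|by rewrite symE ex].
have [->|->] := cyc_induced symE irrE cdE cq xq yq xy.
  by have [i il [E1 E2]] := nx x xq; exists i => //; left.
by have [i il [E1 E2]] := nx y yq; exists i => //; right.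
Qed.

Lemma arc_no_edge s p1 s' p2 a b : is_cycle e (s :: p1 ++ s' :: p2) ->
  a \in p1 -> b \in p2 -> e a b = false.
Proof.
move=> cp ap bp; apply/negP => ab.
case/splitPr: ap cp => p11 p12; case/splitPr: bp => p21 p22.
have -> : s :: (p11 ++ a :: p12) ++ s' :: p21 ++ b :: p22 =
  (s :: p11) ++ (a :: p12 ++ s' :: p21 ++ b :: p22) by rewrite /= -!catA.
move=> /(is_cycle_rot (size (s :: p11))); rewrite rot_size_cat.
have -> : (a :: p12 ++ s' :: p21 ++ b :: p22) ++ (s :: p11) =
  a :: (p12 ++ s' :: p21) ++ b :: (p22 ++ s :: p11) by rewrite /= -!catA /= -!catA.
by move=> /cyc_chord-/(_ symE cdE ab)[]; [case: (p12) | case: (p22)].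
Qed.

Variables A C : {set T}.
Hypotheses (cA : conn e A) (tA : 3 * tau A = w A) (cC : cyc C) (CA : C \subset A).

(** The union of the components of [A :\: C] attached at [u], without [u] itself. *)
Definition hang u := [set x in A :\: C | [exists y in component (A :\: C) x, e u y]].

Lemma hangP u x : reflect (x \in A :\: C /\ exists2 y, y \in component (A :\: C) x & e u y)
  (x \in hang u).
Proof.
rewrite /hang [x \in finset _]in_set; apply: (iffP andP) => -[xA H]; split=> //; first exact/exists_inP.
exact/exists_inP.
Qed.

Lemma C_neq0 : C != set0.
Proof. by rewrite -card_gt0; apply: ltn_trans (cyc_card cC). Qed.

Lemma dis_comp x : x \in A :\: C -> [disjoint component (A :\: C) x & C].
Proof. by move=> xA; apply: disjointWl (comp_sub e xA) (disjointDl _ _). Qed.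

Lemma comp_att x x' u u' : x \in A :\: C -> x' \in component (A :\: C) x ->
  u \in C -> u' \in C -> e x u -> e x' u' -> x = x' /\ u = u'.
Proof.
move=> xA xx' uC u'C; rewrite ![e _ u]symE [e _ u']symE => ux u'x'.
have [] := cyc_comp symE cdE cC (dis_comp xA) uC u'C (comp_refl _ _ _) _ ux u'x' => //.
exact: (conn_comp symE xA (comp_refl _ _ _) xx').
Qed.

Lemma hang_comp u x : x \in hang u -> component (A :\: C) x \subset hang u.
Proof.
move=> /hangP[xA [y yx uy]]; apply/subsetP => z zx; apply/hangP; split.
  exact: (subsetP (comp_sub e xA)).
by exists y; rewrite // (comp_eq symE zx).
Qed.

Lemma hang_inj u u' x : u \in C -> u' \in C -> x \in hang u -> x \in hang u' -> u = u'.
Proof.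
move=> uC u'C /hangP[xA [y yx uy]] /hangP[_ [y' y'x u'y']].
have yA := subsetP (comp_sub e xA) _ yx.
have [] := @comp_att y y' u u' yA _ uC u'C; rewrite ?(comp_eq symE yx) //.
  by rewrite symE.
by rewrite symE.
Qed.

Lemma hang_ex x : x \in A :\: C -> exists2 u, u \in C & x \in hang u.
Proof.
move=> xA; have [y [u [yx uC yu]]] := conn_edge cA CA C_neq0 xA.
by exists u => //; apply/hangP; split=> //; exists y; rewrite // symE.
Qed.

Lemma hang_sub u : hang u \subset A :\: C.
Proof. by apply/subsetP => x /hangP[]. Qed.

Lemma hang_nbr u x : u \in C -> x \in A :\: C -> e u x -> x \in hang u.
Proof. by move=> uC xA ux; apply/hangP; split=> //; exists x; rewrite ?comp_refl. Qed.

Lemma hang_clos u : u \in C -> clos (hang u) (A :\ u).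
Proof.
move=> uC; split.
  apply: subset_trans (hang_sub u) _; apply: setDS; by rewrite sub1set.
move=> a b ah /setD1P[bu bA] ab; have /hangP[aA [y ya uy]] := ah.
have [bC|bC] := boolP (b \in C); last first.
  apply: (subsetP (hang_comp ah)); apply: comp_step aA (comp_refl _ _ _) _ ab.
  by rewrite inE bC.
rewrite symE in uy; have [_ E] := comp_att aA ya bC uC ab uy.
by rewrite E eqxx in bu.
Qed.

Lemma comp_closu u x : u \in C -> x \in hang u -> clos (component (A :\: C) x) (A :\ u).
Proof.
move=> uC xh; apply: clos_trans (hang_clos uC).
apply: clos_sub (clos_comp e _) (hang_comp xh) (hang_sub u).
exact: (subsetP (hang_sub u)).
Qed.

(** Deleting [u] also destroys [C]: the weight drops by [1 + cyc_weight C], which leaves a slack of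
    at most [2 - cyc_weight C] for the parts of [A :\ u]. *)
Lemma cyc_mod u K1 K2 : u \in C -> clos K1 (A :\ u) -> clos K2 (A :\ u) ->
  [disjoint K1 & K2] -> w K1 + w K2 %% 3 + cyc_weight C <= 3 * tau K1 + 2.
Proof.
move=> uC c1 c2 d12.
have [||m [b1 b2]] := three_clos symE irrE cdE c1 c2 (clos0 _ _) d12.
- by rewrite -setI_eq0 setI0.
- by rewrite -setI_eq0 setI0.
have := tau_rem1 e A u; have := floor_bound symE irrE cdE K2.
have wA : w A = 1 + cyc_weight C + w (A :\ u).
  rewrite (weight_remC cdE cC CA (X := [set u])) ?cards1 ?sub1set //.
  by apply/set0Pn; exists u; rewrite set11.
rewrite tau0 in b1; rewrite weight0 in b2; move: b1 b2 tA wA; clear; lia.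
Qed.

Lemma cyc_mod1 u K : u \in C -> clos K (A :\ u) -> w K + cyc_weight C <= 3 * tau K + 2.
Proof.
move=> uC cK; have := cyc_mod uC cK (clos0 e _); rewrite weight0 addn0; apply.
by rewrite -setI_eq0 setI0.
Qed.

Lemma cyc_mod1' u K : u \in C -> clos K (A :\ u) -> w K %% 3 + cyc_weight C <= 2.
Proof.
move=> uC cK; have := cyc_mod1 uC cK; have := floor_bound symE irrE cdE K.
by clear; lia.
Qed.

(** For [u] on [C] the only other residue is 0, by [cyc_mod1']. *)
Definition spiked u := w (hang u) %% 3 == 1.
Definition spikes := [set y in A :\: C |
  [exists u in C, e u y] && (w (component (A :\: C) y) %% 3 == 1)].

Lemma spikesP y : reflect [/\ y \in A :\: C, exists2 u, u \in C & e u y &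
    w (component (A :\: C) y) %% 3 = 1] (y \in spikes).
Proof.
rewrite /spikes [y \in finset _]in_set; apply: (iffP and3P) => [[? /exists_inP ? /eqP ?]|[? ? ?]]; split=> //.
  exact/exists_inP.
exact/eqP.
Qed.

Lemma spiked_spike u : u \in C -> spiked u -> exists2 y, y \in spikes & e u y.
Proof.
move=> uC /eqP wu.
have clh : clos (hang u) (A :\: C).
  apply: (clos_sub (hang_clos uC) (hang_sub u)).
  by apply: setDS; rewrite sub1set.
have [|x xh] := @comps_mod_ex _ e symE (hang u); first by rewrite wu.
rewrite (comp_clos clh xh) => wx.
have /hangP[xA [y yx uy]] := xh.
exists y => //; apply/spikesP; split; [exact: (subsetP (comp_sub e xA))|by exists u|].
rewrite (comp_eq symE yx).
have := cyc_mod1' uC (comp_closu uC xh); move: wx; rewrite /cyc_weight; clear; lia.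
Qed.

Lemma spike_spiked u y : u \in C -> y \in spikes -> e u y -> spiked u /\ cyc_weight C = 1.
Proof.
move=> uC /spikesP[yA _ wy] uy.
have yh := hang_nbr uC yA uy.
have cl1 := comp_closu uC yh.
have cl1' : clos (component (A :\: C) y) (hang u).
  by apply: clos_sub (clos_comp e yA) (hang_comp yh) (hang_sub u).
have cl2 : clos (hang u :\: component (A :\: C) y) (A :\ u).
  by apply: clos_trans (hang_clos uC); apply: (closD symE).
have := cyc_mod uC cl1 cl2; rewrite disjoint_sym disjointDl => /(_ isT).
have := weight_clos symE cl1'; have := floor_bound symE irrE cdE (component (A :\: C) y).
rewrite /spiked; have : 0 < cyc_weight C by []. 
by move: wy; clear; lia.
Qed.

(** Two parts of residue 1 at one cycle vertex would exceed the slack, which is at most 1. *)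
Lemma spike_uniq u y y' : u \in C -> y \in spikes -> y' \in spikes -> e u y -> e u y' ->
  y = y'.
Proof.
move=> uC /spikesP[yA _ wy] /spikesP[y'A _ wy'] uy uy'.
have yh := hang_nbr uC yA uy; have y'h := hang_nbr uC y'A uy'.
have [yy'|yy'] := boolP (y' \in component (A :\: C) y).
  by rewrite symE in uy; rewrite symE in uy'; have [] := comp_att yA yy' uC uC uy uy'.
have := cyc_mod uC (comp_closu uC yh) (comp_closu uC y'h) (comp_disjoint symE yy').
have := floor_bound symE irrE cdE (component (A :\: C) y).
by move: wy wy'; rewrite /cyc_weight; clear; lia.
Qed.

(** The slack is at most 1 and congruent to the weight modulo 3, so it vanishes unless the residue
    is 1. *)
Lemma nonspike_tight x : x \in A :\: C -> [disjoint component (A :\: C) x & spikes] ->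
  3 * tau (component (A :\: C) x) = w (component (A :\: C) x).
Proof.
move=> xA dx; have [u uC xh] := hang_ex xA; have /hangP[_ [y yx uy]] := xh.
have yA := subsetP (comp_sub e xA) _ yx.
have : w (component (A :\: C) x) %% 3 != 1.
  apply/eqP => wx; have : y \in spikes.
    by apply/spikesP; split=> //; [exists u | rewrite (comp_eq symE yx)].
  by rewrite (disjointFr dx yx).
have := cyc_mod1 uC (comp_closu uC xh).
have := tau_bound symE irrE cdE (component (A :\: C) x).
rewrite /cyc_weight; clear; lia.
Qed.

Definition hangs (s : seq T) := [set x | has (fun u => x \in hang u) s].

Lemma in_hangs s x : (x \in hangs s) = has (fun u => x \in hang u) s.
Proof. by rewrite in_set. Qed.

Lemma weight_hangs s : uniq s -> {subset s <= C} -> w (hangs s) %% 3 = count spiked s %% 3.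
Proof.
elim: s => [_ _|u s IH /= /andP[us uniqs] sub].
  suff -> : hangs [::] = set0 by rewrite weight0.
  by apply/setP => x; rewrite !inE.
have uC : u \in C by apply: sub; rewrite mem_head.
have sub' : {subset s <= C} by move=> z zs; apply: sub; rewrite inE zs orbT.
have [hA clh] := hang_clos uC.
have E : hangs (u :: s) = hang u :|: hangs s.
  by apply/setP => x; rewrite in_setU !in_hangs.
have nh x : x \in hang u -> x \in hangs s -> False.
  move=> xu; rewrite inE => /hasP[v vs xv].
  by have E' := hang_inj uC (sub' _ vs) xu xv; rewrite E' vs in us.
rewrite E weight_split //; first last.
- move=> a b a' b' ah a'h bh _ ab _; case: (nh b) => //; apply: clh ah _ ab.
  move: bh; rewrite inE => /hasP[v vs /hangP[/setDP[bA bC] _]].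
  by rewrite in_setD1 bA andbT; apply: contra bC => /eqP->.
- rewrite -setI_eq0; apply/eqP/setP => x; rewrite [RHS]in_set0; apply/negP => /setIP[].
  exact: nh.
rewrite -modnDm IH // modnDmr.
suff -> : w (hang u) %% 3 = spiked u by [].
have := cyc_mod1' uC (hang_clos uC); rewrite /spiked /cyc_weight; clear; lia.
Qed.

Definition branch s := [set x in s] :|: hangs s.

(** The vertex [c] keeps [C] from lying inside the branch, so the vertices of [s] are on no cycle
    there and weigh 1 each. *)
Lemma weight_branch s c : uniq s -> {subset s <= C} -> c \in C -> c \notin s ->
  w (branch s) %% 3 = word_weight spiked s %% 3.
Proof.
move=> us sub cC' cs.
have nh x : x \in C -> x \in hangs s -> False.
  move=> xC; rewrite inE => /hasP[v _ /(subsetP (hang_sub v))].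
  by rewrite inE xC.
rewrite (weight_rem (X := [set x in s])).
- have -> : branch s :\: [set x in s] = hangs s.
    rewrite /branch setDUl setDv set0U; apply/setDidPl; rewrite -setI_eq0.
    apply/eqP/setP => x; rewrite [RHS]in_set0; apply/negP => /setIP[xh].
    by rewrite inE => /sub xC; apply: nh xC xh.
  rewrite cardsE (card_uniqP us) /word_weight -modnDmr weight_hangs // modnDmr //.
- exact: subsetUl.
move=> S cS SA; rewrite -setI_eq0; apply/eqP/setP => x; rewrite [RHS]in_set0.
apply/negP => /setIP[xS]; rewrite inE => xs.
have E := cyc_eq cdE cS cC xS (sub _ xs).
have := subsetP SA c; rewrite E cC' => /(_ isT); rewrite inE => /orP[].
  by rewrite inE (negPf cs).
exact: nh.
Qed.

Definition enum_C q := is_cycle e q /\ [set x in q] = C.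

Lemma enum_Crot a b : enum_C (a ++ b) -> enum_C (b ++ a).
Proof.
move=> [cy E]; split; first by rewrite -rot_size_cat is_cycle_rot.
by rewrite -E; apply/setP => x; rewrite !inE !mem_cat orbC.
Qed.

Lemma enum_Cin q x : enum_C q -> (x \in q) = (x \in C).
Proof. by move=> [_ <-]; rewrite inE. Qed.

(* Delete s and s' and compare residues. *)
Lemma arc_weight s p1 s' p2 : enum_C (s :: p1 ++ s' :: p2) -> spiked s -> spiked s' ->
  word_weight spiked p1 %% 3 <= 1.
Proof.
set q := s :: _ => Eq Ss Ss'; have [cy _] := Eq; have /and3P[uq _ _] := cy.
have inq x : (x \in C) = [|| x == s, x \in p1, x == s' | x \in p2].
  by rewrite -(enum_Cin _ Eq) /q inE mem_cat inE.
have sC : s \in C by rewrite inq eqxx.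
have s'C : s' \in C by rewrite inq eqxx !orbT.
move: uq; rewrite /q /= mem_cat inE !negb_or cat_uniq /= => /andP[/and3P[sp1 ss' sp2]].
rewrite negb_or => /and3P[up1 /andP[s'p1 _] _].
have sub1 : {subset p1 <= C} by move=> z zp; rewrite inq zp orbT.
pose X := [set s; s'].
have XC : X \subset C by rewrite subUset !sub1set sC.
have AX u : u \in X -> A :\: X \subset A :\ u by move=> uX; apply: setDS; rewrite sub1set.
have hX u : hang u \subset A :\: X by apply: subset_trans (hang_sub u) _; apply: setDS.
have c1 : clos (hang s) (A :\: X).
  by apply: (clos_sub (hang_clos sC)); rewrite ?AX ?set21.
have c2 : clos (hang s') (A :\: X).
  by apply: (clos_sub (hang_clos s'C)); rewrite ?AX ?set22.
(* Since [C] has no chords, the arc [p1] reaches the rest of [C] only through [s] and [s']. *)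
have c3 : clos (branch p1) (A :\: X).
  split.
    rewrite subUset; apply/andP; split; apply/subsetP => z; rewrite inE.
      move=> zp; rewrite !inE (subsetP CA) ?sub1 // andbT negb_or.
      by apply/andP; split; apply: contraTneq zp => ->.
    by move=> /hasP[v _]; apply: (subsetP (hX v)).
  move=> a b; rewrite in_setU => /orP[].
    rewrite inE => ap /setDP[bA bX] ab; have [bC|bC] := boolP (b \in C).
      move: bC bX; rewrite inq !inE negb_or => /or4P[->//| bp |-> | bp]; rewrite ?andbF // => _.
        by rewrite bp.
      by rewrite (arc_no_edge cy ap bp) in ab.
    rewrite in_setU; apply/orP; right; rewrite inE; apply/hasP; exists a => //.
    by apply: hang_nbr ab; rewrite ?sub1 // inE bC.
  rewrite inE => /hasP[v vp av] /setDP[bA bX] ab; rewrite in_setU.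
  have [->|bv] := eqVneq b v; first by rewrite inE vp.
  apply/orP; right; rewrite inE; apply/hasP; exists v => //.
  by apply: (proj2 (hang_clos (sub1 _ vp))) av _ ab; rewrite in_setD1 bv.
have dh u v : u \in C -> v \in C -> u != v -> [disjoint hang u & hang v].
  move=> uC vC uv; rewrite -setI_eq0; apply/eqP/setP => z; rewrite [RHS]in_set0.
  apply/negP => /setIP[zu zv]; case/eqP: uv; exact: hang_inj zu zv.
have dhb u : u \in C -> u \notin p1 -> [disjoint hang u & branch p1].
  move=> uC up; rewrite -setI_eq0; apply/eqP/setP => z; rewrite [RHS]in_set0.
  apply/negP => /setIP[zu]; rewrite in_setU => /orP[].
    rewrite inE => /sub1 zC; have := subsetP (hang_sub u) _ zu.
    by rewrite inE zC.
  rewrite inE => /hasP[v vp zv]; have E := hang_inj uC (sub1 _ vp) zu zv.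
  by rewrite E vp in up.
have [m [b1 b2]] := three_clos symE irrE cdE c1 c2 c3 (dh _ _ sC s'C ss')
  (dhb _ sC sp1) (dhb _ s'C s'p1).
have := tau_rem e A X; have := floor_bound symE irrE cdE (hang s).
have := floor_bound symE irrE cdE (hang s').
have := floor_bound symE irrE cdE (branch p1).
have := weight_branch up1 sub1 sC sp1.
have := weight_remC cdE cC CA XC ltac:(by apply/set0Pn; exists s; rewrite set21).
(* Two deletions cost 6, the weight drops by [2 + cyc_weight C], and the residues at [s] and [s']
   use 2; at most [2 - cyc_weight C] remains for the arc. *)
rewrite cards2 ss'; move: b1 b2 tA Ss Ss'; rewrite /spiked /cyc_weight; clear.
lia.
Qed.

Lemma nth_predP (s : T) q x :
  x \in q <-> exists2 i, 0 < i <= size q & nth s q i.-1 = x.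
Proof.
split=> [xq|[i /andP[i0 il] <-]]; last by apply: mem_nth; rewrite prednK.
by exists (index x q).+1; rewrite ?index_mem //= nth_index.
Qed.

Lemma nth_pred_inj (s : T) q i j : uniq q -> 0 < i <= size q -> 0 < j <= size q ->
  nth s q i.-1 = nth s q j.-1 -> i = j.
Proof.
move=> uq /andP[i0 il] /andP[j0 jl] /eqP.
by rewrite nth_uniq ?prednK // => /eqP E; rewrite -(prednK i0) -(prednK j0) E.
Qed.

(** All hanging parts have residue 0, so 3 divides [#|C| + cyc_weight C]; this is impossible when 3
    divides [#|C|]. *)
Lemma cycle_piece : spikes = set0 -> piece e C.
Proof.
move=> sp0; have /cycP[q cq qC] := cC; have /and3P[uq sq _] := cq.
have Eq : enum_C q by [].
have /card_gt0P[s _] : 0 < #|C| by apply: ltn_trans (cyc_card cC).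
have lq : size q = #|C| by rewrite -qC cardsE (card_uniqP uq).
apply: Or32; exists (size q), (fun i => nth s q i.-1); split; last first.
  have w3 : w (A :\: C) %% 3 = 0.
    apply: (comps_mod symE) => x xA; have := nonspike_tight xA; rewrite sp0.
    by rewrite -setI_eq0 setI0 eqxx => /(_ isT); clear; lia.
  have := weight_remC cdE cC CA (subxx _) C_neq0; rewrite lq; move: w3 tA; rewrite /cyc_weight.
  by clear; case: eqP; lia.
split=> //.
- by move=> i j il jl; apply: nth_pred_inj.
- by move=> x; rewrite -(enum_Cin _ Eq); apply: nth_predP.
- by move=> x y; rewrite -!(enum_Cin _ Eq); apply: cycle_edges.
Qed.

Lemma spiked_piece : spikes != set0 -> piece e (C :|: spikes).
Proof.
case/set0Pn => y0 y0s; have /spikesP[y0A [u0 u0C u0y] _] := y0s.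
have [su0 cw1] := spike_spiked u0C y0s u0y.
have /cycP[q0 cq0 q0C] := cC.
have Eq0 : enum_C q0 by [].
have lC q : enum_C q -> size q = #|C|.
  by move=> [/and3P[uq _ _] <-]; rewrite cardsE (card_uniqP uq).
(* Removing [C] takes [#|C| + 1] from the weight and leaves one unit of residue per spiked
   vertex. *)
have w2 q : enum_C q -> word_weight spiked q %% 3 = 2.
  move=> Eq; have [/and3P[uq _ _] _] := Eq.
  have sub : {subset q <= C} by move=> x; rewrite (enum_Cin _ Eq).
  have E : A :\: C = hangs q.
    apply/setP => x; rewrite in_hangs; apply/idP/hasP => [xA|[u _ xu]].
      by have [u uC xu] := hang_ex xA; exists u; rewrite ?(enum_Cin _ Eq).
    exact: (subsetP (hang_sub u)).
  have := weight_remC cdE cC CA (subxx _) C_neq0; rewrite E cw1 -(lC q Eq).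
  have := weight_hangs uq sub; move: tA; rewrite /word_weight; clear; move: (tau A) (w A) (w (hangs q)) (size q) (count spiked q); lia.
have [s [r [Eq Ss H]]] := rotate_spikes enum_Crot w2 arc_weight Eq0
  ltac:(by apply/hasP; exists u0; rewrite ?(enum_Cin _ Eq0)).
move: H; set q := s :: r in Eq *; move=> H.
have [cq qC] := Eq; have /and3P[uq sq _] := cq.
have inq x : (x \in q) = (x \in C) by apply: enum_Cin.
pose u i := nth s q i.-1.
pose idx := spike_idx (fun i => spiked (u i)) (size q).
(* The default [s] is never taken for [i] in [idx], where a spike exists. *)
pose v i := odflt s [pick y in spikes | e (u i) y].
have uC i : 0 < i <= size q -> u i \in C.
  by move=> /andP[i0 il]; rewrite -inq mem_nth // prednK.
have idxP i : i \in idx -> 0 < i <= size q /\ spiked (u i).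
  by rewrite spike_idx_mem => /andP[].
have vP i : i \in idx -> v i \in spikes /\ e (u i) (v i).
  move=> /idxP[il su]; rewrite /v; case: pickP => [y /andP[]//|nop].
  by have [y ys uy] := spiked_spike (uC _ il) su; have := nop y; rewrite ys uy.
have spC y : y \in spikes -> y \notin C by move=> /spikesP[/setDP[]].
have sp_nbr a b y : a \in C -> b \in C -> y \in spikes -> e a y -> e b y -> a = b.
  move=> aC bC /spikesP[yA _ _]; rewrite symE => ya; rewrite symE => yb.
  by have [] := comp_att yA (comp_refl _ _ _) aC bC ya yb.
apply: Or33; exists (size q), idx, u, v; split; last first.
  apply: very_good_spikes_word => //; first exact: w2.
  (* [cyc_weight C = 1] says that the length is not 1 modulo 3, as very good requires. *)
  by rewrite (lC q Eq); move: cw1; rewrite /cyc_weight; case: eqP.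
have s1 : 1 \in idx by rewrite spike_idx_mem /u /= Ss.
have us x : x \in C -> exists2 i, 0 < i <= size q & u i = x.
  by rewrite -inq => /(nth_predP s).
have vs y : y \in spikes -> exists2 i, i \in idx & v i = y.
  move=> ys; have /spikesP[yA [a aC ay] _] := ys.
  have [sa _] := spike_spiked aC ys ay; have [i il ui] := us a aC.
  have iI : i \in idx by rewrite spike_idx_mem ui sa.
  exists i => //; have [vi1 vi2] := vP _ iI; rewrite ui in vi2.
  exact: spike_uniq vi1 ys vi2 ay.
have bothC i x y : 0 < i <= size q -> (x = u i /\ y = u (i %% size q).+1) \/
    (y = u i /\ x = u (i %% size q).+1) -> x \in C /\ y \in C.
  move=> il; have [u1 u2] : u i \in C /\ u (i %% size q).+1 \in C.
    by split; apply: uC => //; rewrite ltn_mod; apply: leq_trans sq.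
  by case=> -[-> ->].
split.
- rewrite sq /=; apply/and3P; split.
  + by case: (idx) s1.
  + by apply: sorted_filter; [apply: ltn_trans | apply: iota_ltn_sorted].
  + by apply/allP => i /idxP[].
- split.
  + by move=> i j il jl; apply: nth_pred_inj.
  + move=> i j iI jI E; have [v1 v2] := vP _ iI; have [v3 v4] := vP _ jI.
    have [il _] := idxP _ iI; have [jl _] := idxP _ jI; rewrite -E in v3 v4.
    have := sp_nbr _ _ _ (uC _ il) (uC _ jl) v1 v2 v4.
    exact: nth_pred_inj.
  + move=> i j il jI E; have [v1 _] := vP _ jI.
    by have := spC _ v1; rewrite -E uC.
- move=> x; rewrite in_setU; split=> [/orP[/us|/vs]|[[i il <-]|[i iI <-]]].
  + by left.
  + by right.
  + by rewrite uC.
  + by have [-> _] := vP _ iI; rewrite orbT.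
move=> x y; rewrite !in_setU => /orP[xC|xS] /orP[yC|yS].
- rewrite (cycle_edges s cq) ?inq //; split=> [[i il H1]|[[i il H1]|[i iI H1]]].
  + by left; exists i.
  + by exists i.
  + have [v1 _] := vP _ iI; have := spC _ v1.
    by case: H1 => -[_ <-]; rewrite ?xC ?yC.
- split=> [xy|[[i il H1]|[i iI [[-> ->]|[E1 E2]]]]].
  + right; have [i iI E] := vs y yS; exists i => //; left.
    have [_ v2] := vP _ iI; have [il _] := idxP _ iI; rewrite E in v2.
    by split=> //; apply: sp_nbr xy v2 => //; apply: uC.
  + by have [_] := bothC _ _ _ il H1; rewrite (negPf (spC _ yS)).
  + by have [] := vP _ iI.
  + have [il _] := idxP _ iI; have := uC _ il.
    by rewrite -E1 (negPf (spC _ yS)).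
- split=> [xy|[[i il H1]|[i iI [[E1 E2]|[-> ->]]]]].
  + right; have [i iI E] := vs x xS; exists i => //; right.
    have [_ v2] := vP _ iI; have [il _] := idxP _ iI; rewrite E in v2.
    by split=> //; rewrite symE in xy; apply: sp_nbr xy v2 => //; apply: uC.
  + by have [] := bothC _ _ _ il H1; rewrite (negPf (spC _ xS)).
  + have [il _] := idxP _ iI; have := uC _ il.
    by rewrite -E1 (negPf (spC _ xS)).
  + by have [_] := vP _ iI; rewrite symE.
- split=> [xy|[[i il H1]|[i iI [[E1 E2]|[E1 E2]]]]].
  (* Adjacent spikes would lie in one component of [A :\: C], which has a single edge to [C]. *)
  + have /spikesP[xA [a aC ax] _] := xS; have /spikesP[yA [b bC byE] _] := yS.
    have yx := comp_step xA (comp_refl e _ _) yA xy.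
    rewrite symE in ax; rewrite symE in byE.
    by have [E _] := comp_att xA yx aC bC ax byE; rewrite E irrE in xy.
  + by have [] := bothC _ _ _ il H1; rewrite (negPf (spC _ xS)).
  + by have [il _] := idxP _ iI; have := uC _ il; rewrite -E1 (negPf (spC _ xS)).
  + by have [il _] := idxP _ iI; have := uC _ il; rewrite -E1 (negPf (spC _ yS)).
Qed.

Lemma tight_cycle :
  (forall B, B \proper A -> conn e B -> B != set0 -> 3 * tau B = w B -> piece_tree e B) ->
  piece_tree e A.
Proof.
move=> IH; apply: (@piece_tree_core _ _ symE irrE cdE A C spikes) => //.
- exact: C_neq0.
- exact: comp_att.
- by apply/subsetP => y /spikesP[].
- by move=> p /spikesP[_ [u uC up] wp]; split=> //; exists u; rewrite // symE.
- exact: nonspike_tight.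
apply: piece_tree1; have [E|] := eqVneq spikes set0; last exact: spiked_piece.
by rewrite E setU0; apply: cycle_piece.
Qed.

End TightCycle.

Section Tight.
Variables (T : finType) (e : rel T).
Hypotheses (symE : symmetric e) (irrE : irreflexive e) (cdE : cycle_disjoint e).

Lemma tight_piece_tree (A : {set T}) :
  conn e A -> A != set0 -> 3 * tau e A = weight e A -> piece_tree e A.
Proof.
have [n] := ubnP #|A|; elim: n A => // n IH A /ltnSE leA cA A0 tA.
have {}IH (B : {set T}) : B \proper A -> conn e B -> B != set0 -> 3 * tau e B = weight e B -> piece_tree e B.
  by move=> /proper_card ltB; apply: IH; apply: leq_trans leA.
have [/existsP[C /andP[cC CA]]|nC] := boolP [exists C, cyc e C && (C \subset A)].
  exact: (tight_cycle symE irrE cdE cA tA cC CA IH).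
apply: (tight_tree symE irrE cdE cA tA _ A0 IH) => S cS.
by apply: contra nC => SA; apply/existsP; exists S; rewrite cS.
Qed.
End Tight.

(** * Pieces are tight *)

Section PieceTight.
Variables (T : finType) (e : rel T).
Hypotheses (symE : symmetric e) (irrE : irreflexive e) (cdE : cycle_disjoint e).
Implicit Types (A B C D K Q S X Y P : {set T}) (x y z : T).
Local Notation w := (weight e).
Local Notation cyc := (cyc e).
Local Notation tau := (tau e).

(** Stated as a sum so that hits can be added up over many copies of P_3. *)
Lemma P3_hit X Y a b c : dissociation e (X :\: Y) -> a \in X -> b \in X -> c \in X ->
  e b a -> e b c -> a != c -> 0 < (a \in Y) + (b \in Y) + (c \in Y).
Proof.
move=> /dissP d aX bX cX ba bc; apply: contraR; rewrite -leqNgt leqn0 !addn_eq0 !eqb0.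
move=> /andP[/andP[aY bY] cY]; apply/eqP; apply: (d b) => //; rewrite inE ?aY ?bY ?cY //.
Qed.

Lemma count_mem_le Y (s : seq T) : uniq s -> count (mem Y) s <= #|Y|.
Proof.
move=> us; rewrite -size_filter -(card_uniqP (filter_uniq (mem Y) us)).
by apply: subset_leq_card; apply/subsetP => x; rewrite mem_filter => /andP[].
Qed.

Lemma weight_le1 X C : (forall S, cyc S -> S \subset X -> S = C) -> w X <= #|X| + cyc_weight C.
Proof.
move=> H; rewrite /weight leq_add2l; have [cC|nC] := boolP (cyc C && (C \subset X)).
  by rewrite (big_pred1 C) // => S /=; apply/andP/eqP => [[]|->]; [apply: H | apply/andP].
rewrite big1 // => S /andP[cS SX]; case/negP: nC.
by rewrite -(H S cS SX) cS SX.
Qed.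

Lemma P3_tight X u v t : P3_on e X u v t -> w X <= 3 * tau X.
Proof.
move=> [EX uv vt ut E].
have cX : #|X| = 3 by rewrite EX setUC cardsU1 cards2 uv !inE negb_or eq_sym ut eq_sym vt.
have uX : u \in X by rewrite EX !inE eqxx.
have vX : v \in X by rewrite EX !inE eqxx orbT.
have tX : t \in X by rewrite EX !inE eqxx !orbT.
have vu : e v u by apply/E => //; apply: Or42.
have vt' : e v t by apply/E => //; apply: Or43.
have -> : w X = 3.
  rewrite /weight cX big1 // => S /andP[cS SX].
  have SE : S = X by apply/eqP; rewrite eqEcard SX cX (cyc_card cS).
  have uS : u \in S by rewrite SE.
  have [y [z [yS zS yz uy uz]]] := cyc_two_nbrs symE cS uS.
  have only d : d \in S -> e u d -> d = v.
    rewrite SE => dX /E-/(_ uX dX)[] [] // E1 E2.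
    - by rewrite E1 eqxx in uv.
    - by rewrite E1 eqxx in uv.
  by rewrite (only y) // (only z) // eqxx in yz.
have [Y [YX dY <-]] := tau_ex e X.
have := P3_hit dY uX vX tX vu vt' ut.
have uL : uniq [:: u; v; t] by rewrite /= !inE negb_or uv ut vt.
by have := count_mem_le Y uL; rewrite /=; clear; lia.
Qed.

(** * Counting deleted vertices around a cycle *)

Section Ring.
Variables (l : nat) (u : nat -> T).
Hypotheses (l3 : 3 <= l)
  (injU : forall i j, 0 < i <= l -> 0 < j <= l -> u i = u j -> i = j)
  (edgeU : forall i, 0 < i <= l -> e (u i) (u (i %% l).+1)).

(* Index in 1, ..., l of the k-th vertex met when winding around u_1, ..., u_l. *)
Definition per k := (k.-1 %% l).+1.

Lemma per_range k : 0 < per k <= l.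
Proof. by rewrite /per /= ltn_mod; apply: leq_trans l3. Qed.

Lemma per_small k : 0 < k <= l -> per k = k.
Proof. by move=> /andP[k0 kl]; rewrite /per modn_small ?prednK. Qed.

Lemma perD k : 0 < k -> per (k + l) = per k.
Proof. by case: k => // k _; rewrite /per addSn /= modnDr. Qed.

Lemma per_edge k : 0 < k -> e (u (per k)) (u (per k.+1)).
Proof.
case: k => // k _; have := edgeU (per_range k.+1).
have E : (k %% l).+1 %% l = k.+1 %% l by rewrite -addn1 modnDml addn1.
by rewrite /per /= E.
Qed.

Lemma ring_cyc : cyc [set x in [seq u i | i <- iota 1 l]].
Proof.
set q := map _ _; have sq : size q = l by rewrite size_map size_iota.
have uq : uniq q.
  rewrite map_inj_in_uniq ?iota_uniq // => i j; rewrite !mem_iota !add1n !ltnS.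
  exact: injU.
have nq k : k < l -> nth (u 0) q k = u k.+1.
  by move=> kl; rewrite (nth_map 0) ?size_iota // nth_iota.
apply/cycP; exists q => //; apply/and3P; split; rewrite ?sq //.
apply: cycle_from_next => // x /(nthP (u 0))[k]; rewrite sq => kl <-.
rewrite next_mod ?sq // !nq ?ltn_mod; [exact: edgeU | by apply: leq_trans l3 | done].
Qed.

Lemma ring_card : #|[set x in [seq u i | i <- iota 1 l]]| = l.
Proof.
rewrite cardsE (card_uniqP _) ?size_map ?size_iota //.
rewrite map_inj_in_uniq ?iota_uniq // => i j; rewrite !mem_iota !add1n !ltnS.
exact: injU.
Qed.

Variables (X Y : {set T}).
Hypotheses (uX : forall i, 0 < i <= l -> u i \in X) (dY : dissociation e (X :\: Y)).
Let x k : nat := u (per k) \in Y.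

Lemma ring_triple k : 0 < k -> 0 < x k + x k.+1 + x k.+2.
Proof.
move=> k0; apply: (P3_hit dY); rewrite ?uX ?per_range ?per_edge //.
  by rewrite symE per_edge.
apply/eqP => /(injU (per_range _) (per_range _)) [] /=.
have -> : k.+1 = k.-1 + 2 by rewrite addn2 prednK.
rewrite -{1}[k.-1]addn0 => /eqP; rewrite eqn_modDl mod0n modn_small //.
Qed.

Lemma ring_triples k t : 0 < k -> t <= \sum_(k <= i < k + 3 * t) x i.
Proof.
elim: t k => // t IH k k0; rewrite (big_cat_nat (n := k + 3)) ?leq_addr //=; last first.
  by rewrite leq_add2l mulnS leq_addr.
have := IH (k + 3); rewrite addn_gt0 k0 => /(_ isT).
rewrite -addnA -mulnS.
have E : \sum_(k <= i < k + 3) x i = x k + x k.+1 + x k.+2.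
  rewrite addn3 big_ltn; last by clear; lia.
  rewrite big_ltn; last by clear; lia.
  by rewrite big_nat1 addnA.
by have := ring_triple k0; rewrite E; clear; lia.
Qed.

Lemma per_shift (f : nat -> nat) a b : (forall k, 0 < k -> f (k + l) = f k) -> 0 < a ->
  \sum_(a + l <= k < b + l) f k = \sum_(a <= k < b) f k.
Proof.
move=> fl a0; rewrite big_addn addnK; apply: eq_big_nat => k /andP[ak _].
by rewrite fl // (leq_trans a0 ak).
Qed.

Lemma sum_count (f : pred nat) a b : \sum_(a <= k < b) f k = count f (index_iota a b).
Proof. by rewrite -sum1_count [RHS]big_mkcond; apply: eq_bigr => k _; case: (f k). Qed.

(** Three laps consist of [l] consecutive triples, each hit at least once, and meet every vertex
    three times; no case distinction on [l] modulo 3 is needed. *)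
Lemma ring_hit : l <= 3 * \sum_(1 <= k < l.+1) x k.
Proof.
have := ring_triples (k := 1) l isT.
have xl k : 0 < k -> x (k + l) = x k by move=> k0; rewrite /x perD.
have E : 1 + 3 * l = 1 + l + l + l by clear; lia.
rewrite E (big_cat_nat (n := 1 + l + l)) /=; [|clear; lia..].
rewrite per_shift // (big_cat_nat (n := 1 + l)) /=; [|clear; lia..].
by rewrite per_shift // add1n; clear; lia.
Qed.

Lemma ring_total : \sum_(1 <= k < l.+1) x k <= #|Y|.
Proof.
have uL : uniq [seq u i | i <- iota 1 l].
  rewrite map_inj_in_uniq ?iota_uniq // => i j; rewrite !mem_iota !add1n !ltnS.
  exact: injU.
apply: leq_trans (count_mem_le Y uL); rewrite count_map sum_count /index_iota subn1 /=.
apply: eq_leq; apply: eq_in_count => k; rewrite mem_iota add1n ltnS => kl /=.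
by rewrite per_small.
Qed.

Variables (idx : seq nat) (v : nat -> T).
Hypotheses (idx_range : forall i, i \in idx -> 0 < i <= l)
  (injV : forall i j, i \in idx -> j \in idx -> v i = v j -> i = j)
  (disUV : forall i j, 0 < i <= l -> j \in idx -> u i <> v j)
  (edgeV : forall i, i \in idx -> e (u i) (v i))
  (vX : forall i, i \in idx -> v i \in X).

(** Deletions at position [k], a spike being counted together with its cycle vertex. *)
Let z k : nat := x k + ((per k \in idx) && (v (per k) \in Y)).

Lemma spike_right k : 0 < k -> per k \in idx -> 0 < z k + x k.+1.
Proof.
move=> k0 kI; rewrite /z kI /= [X in 0 < X + _]addnC; apply: (P3_hit dY).
- exact: vX.
- by rewrite uX ?per_range.
- by rewrite uX ?per_range.
- exact: edgeV.
- exact: per_edge.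
- by rewrite eq_sym; apply/eqP; apply: disUV; rewrite ?per_range.
Qed.

Lemma spike_left k : 0 < k -> per k.+1 \in idx -> 0 < x k + z k.+1.
Proof.
move=> k0 kI; rewrite /z kI /= addnA; apply: (P3_hit dY).
- by rewrite uX ?per_range.
- by rewrite uX ?per_range.
- exact: vX.
- by rewrite symE; apply: per_edge.
- exact: edgeV.
- by apply/eqP; apply: disUV; rewrite ?per_range.
Qed.

Lemma xz a b : \sum_(a <= k < b) x k <= \sum_(a <= k < b) z k.
Proof. by apply: leq_sum => k _; apply: leq_addr. Qed.

Lemma z_triples k t : 0 < k -> t <= \sum_(k <= i < k + 3 * t) z i.
Proof. by move=> k0; apply: leq_trans (xz _ _); apply: ring_triples. Qed.

(** A window of 3t + 2 positions ending in a spiked one contains t triples and the P_3 formed by its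
    last two cycle vertices and the spike. [block_right] is the mirror image. *)
Lemma block_left a t : 0 < a -> per (a + 3 * t).+1 \in idx ->
  t < \sum_(a <= k < (a + 3 * t).+2) z k.
Proof.
move=> a0 aI; rewrite big_nat_recr /=; last by clear; lia.
rewrite big_nat_recr /=; last by clear; lia.
have := spike_left (k := a + 3 * t); rewrite aI addn_gt0 a0 => /(_ isT isT).
have := z_triples t a0; have : x (a + 3 * t) <= z (a + 3 * t) by apply: leq_addr.
by clear; lia.
Qed.

Lemma block_right a t : 0 < a -> per a \in idx ->
  t < \sum_(a <= k < (a + 3 * t).+2) z k.
Proof.
move=> a0 aI; rewrite big_ltn; last by clear; lia.
rewrite big_ltn; last by clear; lia.
have := spike_right a0 aI; have := z_triples t (isT : 0 < a.+2).
have : x a.+1 <= z a.+1 by apply: leq_addr.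
by rewrite !addSn; clear; lia.
Qed.

Lemma spike_total : uniq idx -> \sum_(1 <= k < l.+1) z k <= #|Y|.
Proof.
move=> uI; set I := iota 1 l.
have inI i : i \in I = (0 < i <= l) by rewrite mem_iota add1n ltnS.
have uL : uniq (map u I ++ map v (filter (mem idx) I)).
  rewrite cat_uniq !map_inj_in_uniq ?filter_uniq ?iota_uniq //= ?andbT.
  - apply/hasPn => y /mapP[j]; rewrite mem_filter => /andP[jI _] ->.
    apply/negP => /mapP[i iI E]; apply: (@disUV i j) => //; by rewrite -?inI.
  - move=> i j; rewrite !mem_filter => /andP[iI _] /andP[jI _]; exact: injV.
  - by move=> i j; rewrite !inI; apply: injU.
apply: leq_trans (count_mem_le Y uL); rewrite count_cat !count_map count_filter.
rewrite big_split /= !sum_count /index_iota subn1 /= -/I.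
by apply: leq_add; apply: eq_leq; apply: eq_in_count => k; rewrite inI => kl /=;
  rewrite per_small // andbC.
Qed.

Hypotheses (sortI : sorted ltn idx) (I2 : 1 < size idx)
  (gapI : all (fun j => (nth 0 idx j.+1 - nth 0 idx j) %% 3 == 2) (iota 0 (size idx).-1))
  (wrapI : (l + head 0 idx - last 0 idx) %% 3 == 1).
Local Notation i_ j := (nth 0 idx j).

Lemma sum_cat a b c : a <= b -> b <= c ->
  \sum_(a <= k < c) z k = \sum_(a <= k < b) z k + \sum_(b <= k < c) z k.
Proof. by move=> ab bc; rewrite (big_cat_nat (n := b)). Qed.

(** Each gap is 3t + 2 and yields t + 1 hits, a third of the gap increased by 1. The windows may
    include either the right or the left end of every gap; both versions enter the final count. *)
Lemma gap_chain j : j < size idx ->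
  [/\ i_ 0 <= i_ j, (i_ j - i_ 0 + j) %% 3 = 0,
      i_ j - i_ 0 + j <= 3 * \sum_((i_ 0).+1 <= k < (i_ j).+1) z k &
      i_ j - i_ 0 + j <= 3 * \sum_(i_ 0 <= k < i_ j) z k].
Proof.
elim: j => [|j IH] jI; first by rewrite subnn.
have [le0 m0 c1 c2] := IH (ltnW jI).
have ltj : i_ j < i_ j.+1.
  by apply: (sorted_ltn_nth ltn_trans 0 sortI) => //; rewrite inE ltnW.
have gj : (i_ j.+1 - i_ j) %% 3 = 2.
  by move/allP: gapI => /(_ j); rewrite mem_iota add0n /= ltn_predRL jI => /(_ isT)/eqP.
have [t Et] : exists t, i_ j.+1 = (i_ j + 3 * t).+2.
  by exists ((i_ j.+1 - i_ j) %/ 3); move: gj ltj; clear; lia.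
have rj : 0 < i_ j <= l by apply: idx_range; apply: mem_nth; apply: ltnW.
have rj' : 0 < i_ j.+1 <= l by apply: idx_range; apply: mem_nth.
have pj : per (i_ j) \in idx by rewrite per_small // mem_nth // ltnW.
have pj' : per (i_ j.+1) \in idx by rewrite per_small // mem_nth.
have j0 : 0 < i_ j by case/andP: rj.
have := block_right t j0 pj; rewrite -Et => bR.
have := @block_left (i_ j).+1 t isT; rewrite addSn -Et => /(_ pj') bL.
have cc1 := @sum_cat (i_ 0).+1 (i_ j).+1 (i_ j.+1).+1; rewrite !ltnS in cc1.
have cc2 := @sum_cat (i_ 0) (i_ j) (i_ j.+1).
have {}cc1 := cc1 le0 (ltnW ltj); have {}cc2 := cc2 le0 (ltnW ltj).
move: cc1 cc2 Et le0 m0 c1 c2 bR bL; clear.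
by split; lia.
Qed.

(* The windows of one lap miss a spike pair, so a second lap, shifted so that it
   misses the pair at the other end of the wrap-around gap, is needed. *)
Lemma spiked_hit : l + size idx < 3 * #|Y|.
Proof.
have uI : uniq idx by apply: sorted_uniq sortI; [apply: ltn_trans | move=> i; rewrite /= ltnn].
have zl k : 0 < k -> z (k + l) = z k by move=> k0; rewrite /z /x perD.
have I0 : 0 < size idx by apply: ltnW.
have I1 : (size idx).-1 < size idx by rewrite prednK.
have [le0 m0 c1 c2] := gap_chain I1.
have r0 : 0 < i_ 0 <= l by apply: idx_range; apply: mem_nth.
have rm : 0 < i_ (size idx).-1 <= l by apply: idx_range; apply: mem_nth.
have pm : per (i_ (size idx).-1) \in idx by rewrite per_small // mem_nth.
move: wrapI; rewrite -nth0 -nth_last => /eqP wr.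
move: (i_ (size idx).-1) le0 m0 c1 c2 rm pm wr => m le0 m0 c1 c2 /andP[m0' ml] pm wr.
move: (i_ 0) le0 m0 c1 c2 r0 wr => a le0 m0 c1 c2 /andP[a0 al] wr.
(* The wrap-around gap is 3t + 1: with both ends it is a window of 3t + 2 positions, without them it
   is t triples. *)
have [t Et] : exists t, a + l = (m + 3 * t).+1.
  by exists ((l + a - m) %/ 3); move: wr le0 ml a0; clear; lia.
have bR := block_right t m0' pm.
have tI := z_triples t (isT : 0 < m.+1).
have s1 := sum_cat a0 (leqW al).
have s2 := per_shift a zl (isT : 0 < 1).
have s3 : \sum_(a <= k < a + l) z k = \sum_(a <= k < m) z k + z m + \sum_(m.+1 <= k < a + l) z k.
  rewrite (sum_cat le0); last by rewrite Et; clear; lia.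
  by rewrite (@big_ltn _ _ _ m) ?addnA // Et; clear; lia.
have s4 : \sum_(a <= k < a + l) z k =
    z a + \sum_(a.+1 <= k < m.+1) z k + \sum_(m.+1 <= k < a + l) z k.
  rewrite (@big_ltn _ _ _ a); last by move: al a0; clear; lia.
  by rewrite -addnA -sum_cat // Et; clear; lia.
have s5 : \sum_(m <= k < (m + 3 * t).+2) z k = z m + \sum_(m.+1 <= k < a + l) z k + z a.
  rewrite big_nat_recr /= -?Et ?zl //; last by rewrite Et; clear; lia.
  by rewrite big_ltn // Et; clear; lia.
have s6 : \sum_(a <= k < a + l) z k = \sum_(a <= k < l.+1) z k + \sum_(l.+1 <= k < a + l) z k.
  by rewrite -sum_cat //; move: al a0; clear; lia.
have := spike_total uI; rewrite s1; move: s2; rewrite add1n => s2.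
move: tI; rewrite addSn -Et => tI.
(* Both laps together bound six times the hits of one lap below by [2 * (l + size idx) - 1]. As
   [l + size idx] is 2 modulo 3, strict inequality follows. *)
move: bR s2 s3 s4 s5 s6 tI m0 c1 c2 le0 Et I0; clear; lia.
Qed.
End Ring.

Lemma mem_ring l (u : nat -> T) x :
  x \in [set x in [seq u i | i <- iota 1 l]] <-> exists2 i, 0 < i <= l & u i = x.
Proof.
rewrite inE; split=> [/mapP[i]|[i il <-]]; last by apply: map_f; rewrite mem_iota add1n ltnS.
by rewrite mem_iota add1n ltnS => il ->; exists i.
Qed.

Lemma cycle_tight X l u : cycle_on e X l u -> l %% 3 != 0 -> w X <= 3 * tau X.
Proof.
move=> [l3 injU memX edges] nl.
have EX : X = [set x in [seq u i | i <- iota 1 l]].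
  apply/setP => x; apply/idP/idP; first by move/memX/mem_ring.
  by move/mem_ring/memX.
have uX i : 0 < i <= l -> u i \in X by move=> il; apply/memX; exists i.
have l0 : 0 < l by apply: leq_trans l3.
have edgeU i : 0 < i <= l -> e (u i) (u (i %% l).+1).
  move=> il; apply/edges; rewrite ?uX //= ?ltn_mod //.
  by exists i => //; left.
have cX : cyc X by rewrite EX; apply: ring_cyc.
have lX : #|X| = l by rewrite EX; apply: ring_card.
have : w X <= #|X| + cyc_weight X.
  apply: weight_le1 => S cS SX; have /card_gt0P[x xS] : 0 < #|S| by apply: ltn_trans (cyc_card cS).
  by apply: (cyc_eq cdE cS cX xS); apply: (subsetP SX).
have [Y [YX dY <-]] := tau_ex e X.
(* Rounding [l] up to a multiple of 3 gains 2 or 1, exactly [cyc_weight X]. *)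
have := ring_hit l3 injU edgeU uX dY.
have := ring_total injU Y.
by move: nl; rewrite /cyc_weight lX; clear; lia.
Qed.

Lemma spiked_tight X l idx u v : spiked_on e X l idx u v -> very_good_spikes l idx ->
  w X <= 3 * tau X.
Proof.
move=> [/and4P[l3 _ sortI /allP rI] [injU injV disUV] memX edges].
case/andP=> /orP[/andP[_ ->]//|/and3P[I2 gapI wrapI]] nl.
have uX i : 0 < i <= l -> u i \in X by move=> il; apply/memX; left; exists i.
have vX i : i \in idx -> v i \in X by move=> il; apply/memX; right; exists i.
have l0 : 0 < l by apply: leq_trans l3.
have edgeU i : 0 < i <= l -> e (u i) (u (i %% l).+1).
  move=> il; apply/edges; rewrite ?uX //= ?ltn_mod //.
  by left; exists i => //; left.
have edgeV i : i \in idx -> e (u i) (v i).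
  move=> iI; apply/edges; [by rewrite uX // rI|exact: vX|].
  by right; exists i => //; left.
pose C := [set x in [seq u i | i <- iota 1 l]].
have cC : cyc C by apply: ring_cyc.
have lC : #|C| = l by apply: ring_card.
have : w X <= #|X| + cyc_weight C.
  apply: weight_le1 => S cS SX; have /card_gt0P[x xS] : 0 < #|S| by apply: ltn_trans (cyc_card cS).
  have /memX[uS|[i iI vx]] := subsetP SX _ xS.
    by apply: (cyc_eq cdE cS cC xS); apply/mem_ring.
  (* A cycle through a spike passes to the only neighbour of the spike, which lies on [C]. *)
  have [y [_ [yS _ _ xy _]]] := cyc_two_nbrs symE cS xS.
  apply: (cyc_eq cdE cS cC yS); apply/mem_ring.
  have /edges : e x y by []; move=> /(_ (subsetP SX _ xS) (subsetP SX _ yS)).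
  case=> [[j jl [[E _]|[E _]]]|[j jI [[E _]|[E _]]]].
  - by case: (disUV j i jl iI); rewrite vx.
  - by exists j.
  - by case: (disUV j i (rI _ jI) iI); rewrite vx.
  - by exists j => //; apply: rI.
have cX : #|X| <= l + size idx.
  have -> : l + size idx = size ([seq u i | i <- iota 1 l] ++ [seq v i | i <- idx]).
    by rewrite size_cat !size_map size_iota.
  apply: leq_trans (card_size _); apply: subset_leq_card; apply/subsetP => x /memX H.
  rewrite mem_cat; case: H => [[i il <-]|[i iI <-]]; apply/orP; [left|right]; apply: map_f => //.
  by rewrite mem_iota add1n ltnS.
have [Y [YX dY <-]] := tau_ex e X.
have := spiked_hit l3 injU edgeU uX dY rI injV disUV edgeV vX sortI I2 gapI wrapI.
by move: cX nl; rewrite /cyc_weight lC; clear; lia.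
Qed.

Lemma piece_tight X : piece e X -> w X <= 3 * tau X.
Proof.
case=> [[u [v [t p]]]|[l [u [p nl]]]|[l [idx [u [v [p vg]]]]]].
- exact: P3_tight p.
- exact: cycle_tight p nl.
- exact: spiked_tight p vg.
Qed.

Lemma piece_tree_tight A : piece_tree e A -> w A <= 3 * tau A.
Proof.
elim=> {A} [X /piece_tight //|A X a z tA IH /piece_tight pX dAX aX zA az one].
rewrite weight_split //; first by have := tau_super e dAX; move: IH pX; clear; lia.
move=> x y x' y' xA x'A yX y'X xy x'y'; rewrite symE in xy; rewrite symE in x'y'.
by have [-> ->] := one _ _ yX xA xy; have [-> ->] := one _ _ y'X x'A x'y'.
Qed.

End PieceTight.

(** * Counting edges *)

Section EdgeCount.
Variables (T : finType) (e : rel T).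
Hypotheses (symE : symmetric e) (irrE : irreflexive e) (cdE : cycle_disjoint e).
Implicit Types (A B C D K Q S X Y P : {set T}) (x y z : T).
Local Notation cyc := (cyc e).

Definition edges_in B : {set {set T}} :=
  [set E : {set T} | [exists x, exists y, [&& x \in B, y \in B, e x y & E == [set x; y]]]].
Definition cycles_in B := [set S : {set T} | cyc S && (S \subset B)].

Lemma edges_inP B (E : {set T}) :
  reflect (exists x y, [/\ x \in B, y \in B, e x y & E = [set x; y]]) (E \in edges_in B).
Proof.
rewrite inE; apply: (iffP existsP) => [[x /existsP[y /and4P[? ? ? /eqP ?]]]|[x [y [? ? ? ->]]]].
  by exists x, y.
by exists x; apply/existsP; exists y; apply/and4P; split.
Qed.

Lemma conn_add B x y : conn e B -> y \in B -> e y x -> conn e (x |: B).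
Proof.
move=> cB yB yx; have sub a : a \in B -> a \in component e (x |: B) y.
  move=> aB; have := cB y a yB aB; rewrite !inE; apply: connect_sub => c d.
  move=> /and3P[cB' dB cd]; apply: connect1.
  by rewrite /indrel /= cd !inE cB' dB !orbT.
have yB' : y \in x |: B by rewrite inE yB orbT.
have xK : x \in component e (x |: B) y.
  by apply: comp_step (comp_refl _ _ _) _ yx; rewrite // setU11.
have all_in a : a \in x |: B -> a \in component e (x |: B) y.
  by rewrite inE => /orP[/set1P->|/sub].
by move=> a b aB bB; rewrite (comp_eq symE (all_in a aB)) all_in.
Qed.

Lemma edges_add B x : x \notin B ->
  #|edges_in (x |: B)| = #|edges_in B| + #|[set y in B | e x y]|.
Proof.
move=> xB; set N := [set y in B | e x y].
have inN y : y \in N = (y \in B) && e x y by rewrite inE.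
have -> : edges_in (x |: B) = edges_in B :|: [set [set x; y] | y in N].
  apply/setP => E; rewrite in_setU; apply/edges_inP/orP.
    move=> [a [b [aB bB ab EE]]]; move: aB bB; rewrite !in_setU1.
    move=> /predU1P[Ea|aB] /predU1P[Eb|bB].
    - by rewrite Ea Eb irrE in ab.
    - by right; apply/imsetP; exists b; rewrite ?inN ?bB -?Ea.
    - right; apply/imsetP; exists a; rewrite ?inN ?aB -?Eb 1?symE //.
      by rewrite EE setUC.
    - by left; apply/edges_inP; exists a, b.
  case=> [/edges_inP[a [b [aB bB ab EE]]]|/imsetP[y]].
    by exists a, b; rewrite !in_setU1 aB bB !orbT.
  by rewrite inN => /andP[yB xy] ->; exists x, y; rewrite !in_setU1 eqxx yB orbT.
rewrite cardsU; have -> : edges_in B :&: [set [set x; y] | y in N] = set0.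
  apply/setP => E; rewrite in_setI [RHS]in_set0; apply/negP => /andP[].
  move=> /edges_inP[a [b [aB bB ab ->]]] /imsetP[y _ /setP/(_ x)].
  rewrite !inE eqxx /= => /orP[]/eqP E'; by rewrite E' ?aB ?bB in xB.
rewrite cards0 subn0 card_in_imset // => y y'; rewrite !inN => /andP[yB _] /andP[y'B _].
move=> /setP/(_ y); rewrite !inE eqxx orbT => /esym/orP[/eqP E|/eqP //].
by rewrite -E yB in xB.
Qed.

(** Two neighbours of [x] are joined inside [B] and close a cycle. A third would lie on a further
    cycle through [x], hence on the same one, where [x] has only two neighbours. *)
Lemma cycles_add B x y0 : conn e B -> x \notin B -> y0 \in B -> e x y0 ->
  #|cycles_in (x |: B)| + 1 = #|cycles_in B| + #|[set y in B | e x y]|.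
Proof.
move=> cB xB y0B xy0; set N := [set y in B | e x y].
have inN y : y \in N = (y \in B) && e x y by rewrite inE.
pose M := [set S : {set T} | [&& cyc S, S \subset x |: B & x \in S]].
have inM S : S \in M = [&& cyc S, S \subset x |: B & x \in S] by rewrite inE.
have -> : cycles_in (x |: B) = cycles_in B :|: M.
  apply/setP => S; rewrite in_setU inM ![S \in cycles_in _]inE; case: (cyc S) => //=.
  have [xS|xS] := boolP (x \in S); rewrite ?andbT ?andbF ?orbF.
    case: (boolP (S \subset B)) => //= SB; by rewrite (subset_trans SB) ?subsetUr.
  apply/idP/idP => [SB|/subset_trans]; last by apply; apply: subsetUr.
  apply/subsetP => y yS; have := subsetP SB _ yS; rewrite in_setU1 => /predU1P[E|//].
  by rewrite -E yS in xS.
rewrite cardsU; have -> : cycles_in B :&: M = set0.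
  apply/setP => S; rewrite in_setI inM [RHS]in_set0 inE; apply/negP.
  by move=> /andP[/andP[_ SB] /and3P[_ _ /(subsetP SB)]]; rewrite (negPf xB).
rewrite cards0 subn0 -addnA; congr (_ + _).
have y0N : y0 \in N by rewrite inN y0B.
have nbN S y : S \subset x |: B -> y \in S -> e x y -> y \in N.
  move=> SB yS xy; have := subsetP SB _ yS; rewrite in_setU1 inN xy andbT.
  by case/predU1P => // E; rewrite E irrE in xy.
have [[y1 y1N n01]|all0] : (exists2 y, y \in N & y0 != y) \/ (forall y, y \in N -> y = y0).
  have [/existsP[y /andP[yN ny]]|nex] := boolP [exists y, (y \in N) && (y0 != y)].
    by left; exists y.
  right=> y yN; apply/eqP; rewrite eq_sym; apply: contraR nex => ny; apply/existsP; exists y.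
  by rewrite yN.
  have cyN y : y \in N -> y0 != y -> exists S, [/\ cyc S, x \in S, y0 \in S, y \in S & S \subset x |: B].
    rewrite inN => /andP[yB xy] ny; apply: (cyc_nbrs symE xB y0B _ ny xy0 xy).
    exact: cB.
  have [S [cS xS y0S y1S SB]] := cyN y1 y1N n01.
  have -> : M = [set S].
    apply/setP => S'; rewrite inM in_set1; apply/and3P/eqP => [[cS' _ xS']|->//].
    exact: (cyc_eq cdE cS' cS xS' xS).
  have -> : N = [set y0; y1].
    apply/setP => y; rewrite in_set2; apply/idP/idP => [yN|/orP[]/eqP-> //].
    have [//|ny] := eqVneq y y0.
    have [|S' [cS' xS' _ yS' _]] := cyN y yN; first by rewrite eq_sym.
    rewrite (cyc_eq cdE cS' cS xS' xS) in yS'.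
    move: (y1N) (yN); rewrite !inN => /andP[_ xy1] /andP[_ xy].
    have := cyc_nbrs_le2 symE irrE cdE cS xS y0S y1S yS' xy0 xy1 xy.
    by rewrite (negPf n01) [y0 == y]eq_sym (negPf ny) orbF eq_sym.
  by rewrite cards1 cards2 n01.
have -> : M = set0.
  apply/setP => S; rewrite inM [RHS]in_set0; apply/negP => /and3P[cS SB xS].
  have [y [z [yS zS yz xy xz]]] := cyc_two_nbrs symE cS xS.
  by rewrite (all0 _ (nbN _ _ SB yS xy)) (all0 _ (nbN _ _ SB zS xz)) eqxx in yz.
have -> : N = [set y0].
  by apply/setP => y; rewrite in_set1; apply/idP/eqP => [/all0 //|->].
by rewrite cards0 cards1.
Qed.

Hypothesis cT : connected_graph e.

Lemma connT : conn e [set: T].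
Proof.
move=> x y _ _; rewrite inE; have := cT x y; apply: connect_sub => a b ab.
by apply: connect1; rewrite /indrel /= !inE.
Qed.

(* Grow a connected set vertex by vertex: a new vertex has one neighbour in the set
   and closes no cycle, or two and closes exactly one. *)
Lemma edge_count : 0 < #|T| -> n_edges e + 1 = #|T| + #|cycles_in [set: T]|.
Proof.
move=> T0.
suff H n : n < #|T| -> exists B, [/\ #|B| = n.+1, conn e B &
    #|edges_in B| + 1 = #|B| + #|cycles_in B|].
  have [|B [cB _]] := H #|T|.-1; first by rewrite prednK.
  have -> : B = [set: T].
    by apply/eqP; rewrite eqEcard subsetT cardsT cB (prednK T0) leqnn.
  rewrite cardsT => <-; congr (_ + _); apply: eq_card => E; rewrite !inE.
  by apply: eq_existsb => x; apply: eq_existsb => y; rewrite !inE.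
elim: n => [_|n IH ltn].
  have /card_gt0P[t _] := T0; exists [set t]; rewrite cards1; split=> //.
    by move=> x y /set1P-> /set1P->; apply: comp_refl.
  have -> : edges_in [set t] = set0.
    apply/setP => E; rewrite [RHS]in_set0; apply/edges_inP => -[x [y [/set1P-> /set1P->]]].
    by rewrite irrE.
  have -> : cycles_in [set t] = set0.
    apply/setP => S; rewrite [RHS]in_set0 inE; apply/negP => /andP[cS /subset_leq_card].
    by rewrite cards1 => /(leq_trans (cyc_card cS)).
  by rewrite !cards0.
have [B [sB cB EB]] := IH (ltnW ltn).
have [x0 x0B] : exists x, x \in [set: T] :\: B.
  apply/set0Pn; rewrite -card_gt0 cardsD setTI cardsT sB subn_gt0 //.
have B0 : B != set0 by rewrite -card_gt0 sB.
have [x [y [xK yB xy]]] := conn_edge connT (subsetT B) B0 x0B.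
have xB : x \notin B by have := subsetP (comp_sub e x0B) _ xK; rewrite inE => /andP[].
have yx : e y x by rewrite symE.
exists (x |: B); split.
- by rewrite cardsU1 xB sB.
- exact: conn_add cB yB yx.
- have := edges_add xB; have := cycles_add cB xB yB xy; rewrite cardsU1 xB.
  by move: EB; clear; lia.
Qed.

(** There are no chords, so [c1] ranges over all cycles. *)
Lemma induced_cyc S : induced_cycle_set e S = cyc S.
Proof.
apply: eq_existsb => t; apply/and3P/andP => [[-> -> _]//|[ct tS]]; split=> //.
apply/forallP => x; apply/forallP => y; apply/implyP => /andP[/andP[xS yS] xy].
have inS z : z \in S -> z \in val t by rewrite -[in z \in S](eqP tS) inE.
have xt := inS x xS; have yt := inS y yS.
by have [->|->] := cyc_induced symE irrE cdE ct xt yt xy; rewrite eqxx ?orbT.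
Qed.

Lemma weight_setT : 0 < #|T| -> weight e [set: T] = n_edges e + 1 + c1 e.
Proof.
move=> T0; rewrite edge_count // /weight cardsT -addnA; congr (_ + _).
rewrite big_split /= sum1_card; congr (_ + _).
  by apply: eq_card => S; rewrite [RHS]inE.
rewrite /c1 -sum1_card [RHS]big_mkcond [LHS]big_mkcond; apply: eq_bigr => S _ /=.
by rewrite !inE induced_cyc subsetT andbT; case: (cyc S); case: eqP.
Qed.

Lemma diss_tau : diss e + tau e [set: T] = #|T|.
Proof.
rewrite /tau cardsT; have -> : \max_(D | dissociation e D && (D \subset [set: T])) #|D| = diss e.
  by apply: eq_bigl => D; rewrite subsetT andbT.
apply: subnKC; apply/bigmax_leqP => D _; exact: max_card.
Qed.

Lemma eq_tight : 0 < #|T| ->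
  3 * tau e [set: T] = weight e [set: T] <->
  3 * diss e + (n_edges e + 1 + c1 e) = 3 * #|T|.
Proof.
move=> T0; rewrite weight_setT //; have := diss_tau; clear; lia.
Qed.
End EdgeCount.

(** * Trees of pieces and the class C *)

Section Transport.
Variables (T T' : finType) (e : rel T) (e' : rel T') (f : T' -> T).
Hypotheses (injf : injective f) (ee : forall x y, e' x y = e (f x) (f y)).
Implicit Types (X : {set T'}).

Lemma P3_on_inj X u v w : P3_on e' X u v w <-> P3_on e (f @: X) (f u) (f v) (f w).
Proof.
have EX : X = [set u; v; w] <-> f @: X = [set f u; f v; f w].
  have -> : [set f u; f v; f w] = f @: [set u; v; w] by rewrite !imsetU !imset_set1.
  by split=> [->//|]; apply: imset_inj.
split=> -[/EX E uv vw uw H]; split=> //; rewrite ?(inj_eq injf) // in uv vw uw *.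
  move=> _ _ /imsetP[x xX ->] /imsetP[y yX ->]; rewrite -ee H //.
  by split=> -[[E1 E2]|[E1 E2]|[E1 E2]|[E1 E2]]; [apply: Or41|apply: Or42|apply: Or43|apply: Or44
    |apply: Or41|apply: Or42|apply: Or43|apply: Or44]; split; rewrite ?E1 ?E2 //; apply: injf.
move=> x y xX yX; rewrite ee H ?imset_f //.
by split=> -[[E1 E2]|[E1 E2]|[E1 E2]|[E1 E2]]; [apply: Or41|apply: Or42|apply: Or43|apply: Or44
    |apply: Or41|apply: Or42|apply: Or43|apply: Or44]; split; rewrite ?E1 ?E2 //; apply: injf.
Qed.

(** The enumerations need to correspond only on 1, ..., l, since a pulled-back one takes a default
    value elsewhere. *)
Lemma cycle_on_inj X l u u' : (forall i, 0 < i <= l -> u i = f (u' i)) ->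
  cycle_on e' X l u' <-> cycle_on e (f @: X) l u.
Proof.
move=> uf.
have uf' i : 0 < i <= l -> u (i %% l).+1 = f (u' (i %% l).+1).
  by move=> /andP[i0 il]; rewrite uf //= ltn_mod (leq_trans i0 il).
have fE x i : 0 < i <= l -> (f x = u i) <-> (x = u' i).
  by move=> il; rewrite uf //; split=> [/injf|->].
have fE' x i : 0 < i <= l -> (f x = u (i %% l).+1) <-> (x = u' (i %% l).+1).
  by move=> il; rewrite uf' //; split=> [/injf|->].
have edgeE x y : (exists2 i, 0 < i <= l & (x = u' i /\ y = u' (i %% l).+1) \/
      (y = u' i /\ x = u' (i %% l).+1)) <->
    (exists2 i, 0 < i <= l & (f x = u i /\ f y = u (i %% l).+1) \/
      (f y = u i /\ f x = u (i %% l).+1)).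
  by split=> -[i il]; (move=> H; exists i => //); move: H; rewrite !(fE _ i il) !(fE' _ i il).
have memE x : (exists2 i, 0 < i <= l & u' i = x) <-> (exists2 i, 0 < i <= l & u i = f x).
  split=> -[i il E]; exists i => //; first by rewrite uf // E.
  by apply: injf; rewrite -uf.
split=> -[l3 inj mem edg]; split=> //.
- by move=> i j il jl; rewrite !uf // => /injf; apply: inj.
- move=> x; split=> [/imsetP[y yX ->]|[i il <-]]; first by apply/memE/mem.
  by rewrite uf // imset_f //; apply/mem; exists i.
- by move=> _ _ /imsetP[x xX ->] /imsetP[y yX ->]; rewrite -ee edg.
- by move=> i j il jl E; apply: inj => //; rewrite !uf // E.
- by move=> x; rewrite memE -mem mem_imset.
- by move=> x y xX yX; rewrite ee edg ?imset_f // edgeE.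
Qed.

Lemma spiked_on_inj X l idx u u' v v' : (forall i, 0 < i <= l -> u i = f (u' i)) ->
  (forall i, i \in idx -> v i = f (v' i)) ->
  spiked_on e' X l idx u' v' <-> spiked_on e (f @: X) l idx u v.
Proof.
move=> uf vf.
suff H : [&& 3 <= l, 0 < size idx, sorted ltn idx & all (fun i => 0 < i <= l) idx] ->
    spiked_on e' X l idx u' v' <-> spiked_on e (f @: X) l idx u v.
  by split=> h; apply/H => //; case: h.
move=> /and4P[l3 s0 so /allP rI].
have uf' i : 0 < i <= l -> u (i %% l).+1 = f (u' (i %% l).+1).
  by move=> /andP[i0 il]; rewrite uf //= ltn_mod (leq_trans i0 il).
have fE x i : 0 < i <= l -> (f x = u i) <-> (x = u' i).
  by move=> il; rewrite uf //; split=> [/injf|->].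
have fE' x i : 0 < i <= l -> (f x = u (i %% l).+1) <-> (x = u' (i %% l).+1).
  by move=> il; rewrite uf' //; split=> [/injf|->].
have fV x i : i \in idx -> (f x = v i) <-> (x = v' i).
  by move=> il; rewrite vf //; split=> [/injf|->].
have edgeE x y : (exists2 i, 0 < i <= l & (x = u' i /\ y = u' (i %% l).+1) \/
      (y = u' i /\ x = u' (i %% l).+1)) <->
    (exists2 i, 0 < i <= l & (f x = u i /\ f y = u (i %% l).+1) \/
      (f y = u i /\ f x = u (i %% l).+1)).
  by split=> -[i il]; (move=> H; exists i => //); move: H; rewrite !(fE _ i il) !(fE' _ i il).
have edgeE' x y : (exists2 i, i \in idx & (x = u' i /\ y = v' i) \/
      (y = u' i /\ x = v' i)) <->
    (exists2 i, i \in idx & (f x = u i /\ f y = v i) \/ (f y = u i /\ f x = v i)).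
  by split=> -[i iI]; (move=> H; exists i => //); have il := rI _ iI;
     move: H; rewrite !(fE _ i il) !(fV _ i iI).
have memE x : (exists2 i, 0 < i <= l & u' i = x) <-> (exists2 i, 0 < i <= l & u i = f x).
  split=> -[i il E]; exists i => //; first by rewrite uf // E.
  by apply: injf; rewrite -uf.
have memE' x : (exists2 i, i \in idx & v' i = x) <-> (exists2 i, i \in idx & v i = f x).
  split=> -[i il E]; exists i => //; first by rewrite vf // E.
  by apply: injf; rewrite -vf.
split=> -[h1 [inj1 inj2 dis] mem edg]; split=> //.
- split.
  + by move=> i j il jl; rewrite !uf // => /injf; apply: inj1.
  + by move=> i j il jl; rewrite !vf // => /injf; apply: inj2.
  + by move=> i j il jI; rewrite uf // vf // => /injf; apply: dis.
- move=> x; split=> [/imsetP[y yX ->]|[[i il <-]|[i iI <-]]].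
  + by rewrite -memE -memE'; apply/mem.
  + by rewrite uf // imset_f //; apply/mem; left; exists i.
  + by rewrite vf // imset_f //; apply/mem; right; exists i.
- by move=> _ _ /imsetP[x xX ->] /imsetP[y yX ->]; rewrite -ee edg // edgeE edgeE'.
- split.
  + by move=> i j il jl E; apply: inj1 => //; rewrite !uf // E.
  + by move=> i j il jl E; apply: inj2 => //; rewrite !vf // E.
  + by move=> i j il jI E; apply: (dis i j) => //; rewrite uf // vf // E.
- by move=> x; rewrite memE memE' -mem mem_imset.
- by move=> x y xX yX; rewrite ee edg ?imset_f // edgeE edgeE'.
Qed.
End Transport.

Lemma P3_on_rev (T : finType) (e : rel T) (X : {set T}) u v w :
  P3_on e X u v w -> P3_on e X w v u.
Proof.
move=> [E uv vw uw H]; split; rewrite 1?eq_sym //.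
  by rewrite E; apply/setP => x; rewrite !inE; do 3!case: eqP.
move=> x y xX yX; rewrite H //.
by split=> -[[-> ->]|[-> ->]|[-> ->]|[-> ->]];
  [apply: Or44|apply: Or43|apply: Or42|apply: Or41|apply: Or44|apply: Or43|apply: Or42|apply: Or41].
Qed.

(** The operations pass to the subtype [rest X], so the induction carries an embedding into one
    graph. *)
Lemma inC_piece_tree (T' : finType) (e' : rel T') : inC e' ->
  forall (T : finType) (e : rel T) (f : T' -> T), symmetric e -> injective f ->
  (forall x y, e' x y = e (f x) (f y)) -> piece_tree e (f @: [set: T']).
Proof.
have step (T1 T : finType) (e1 : rel T1) (e : rel T) (f : T1 -> T) (X : {set T1}) a z :
    symmetric e -> injective f -> (forall x y, e1 x y = e (f x) (f y)) ->
    piece e (f @: X) -> attached e1 X a z ->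
    (forall (T : finType) (e : rel T) (f : rest X -> T), symmetric e -> injective f ->
       (forall x y, del_rel e1 x y = e (f x) (f y)) -> piece_tree e (f @: [set: rest X])) ->
    piece_tree e (f @: [set: T1]).
  move=> symE injf ee pX [aX zX att] IH.
  have memR x : (f x \in (f \o val) @: [set: rest X]) = (x \notin X).
    apply/imsetP/idP => [[y _ /injf ->]|xX]; first exact: (valP y).
    by exists (Sub x xX).
  have -> : f @: [set: T1] = (f \o val) @: [set: rest X] :|: f @: X.
    apply/setP => y; rewrite in_setU; apply/imsetP/orP => [[x _ ->]|[]/imsetP[x _ ->]].
    - by rewrite memR mem_imset //; case: (x \in X); [right | left].
    - by exists (val x).
    - by exists x.
  have dj : [disjoint (f \o val) @: [set: rest X] & f @: X].
    rewrite -setI_eq0; apply/eqP/setP => y; rewrite [RHS]in_set0; apply/negP => /setIP[].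
    by move=> /[swap] /imsetP[x xX ->]; rewrite memR xX.
  apply: (piece_treeU (a := f a) (z := f z)) => //.
  - by apply: IH => // x y; [move=> /injf/val_inj | apply: ee].
  - exact: imset_f.
  - by rewrite memR.
  - by rewrite -ee; apply/att.
  - move=> _ _ /imsetP[x xX ->] /imsetP[y _ ->]; rewrite /= -ee => /att.
    by move=> /(_ xX (valP y)) [-> ->].
elim=> {T' e'} [T1 e1 u v w p|T1 e1 l u p nl|T1 e1 l idx u v p vg
  |T1 e1 X u v w z p att _ IH|T1 e1 X v u u' z p att _ IH|T1 e1 X l u a z p nl att _ IH
  |T1 e1 X l idx u v a z p vg att _ IH] T e f symE injf ee.
- by apply: piece_tree1; apply: Or31; exists (f u), (f v), (f w); apply/(P3_on_inj injf ee).
- apply: piece_tree1; apply: Or32; exists l, (f \o u); split=> //.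
  by apply/(cycle_on_inj injf ee); last exact: p.
- apply: piece_tree1; apply: Or33; exists l, idx, (f \o u), (f \o v); split=> //.
  by apply/(spiked_on_inj injf ee); last exact: p.
- apply: (step _ _ _ _ _ X w z) => //.
  by apply: Or31; exists (f u), (f v), (f w); apply/(P3_on_inj injf ee).
- apply: (step _ _ _ _ _ X v z) => //.
  by apply: Or31; exists (f u), (f v), (f u'); apply/(P3_on_inj injf ee).
- apply: (step _ _ _ _ _ X a z) => //; apply: Or32; exists l, (f \o u); split=> //.
  by apply/(cycle_on_inj injf ee); last exact: p.
- apply: (step _ _ _ _ _ X a z) => //; apply: Or33; exists l, idx, (f \o u), (f \o v); split=> //.
  by apply/(spiked_on_inj injf ee); last exact: p.
Qed.

Lemma piece_nonempty (T : finType) (e : rel T) (X : {set T}) : piece e X -> exists x, x \in X.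
Proof.
case=> [[u [v [w [-> _ _ _ _]]]]|[l [u [[l3 _ mem _] _]]]|[l [idx [u [v [[/and4P[l3 _ _ _] _ mem _] _]]]]]].
- by exists u; rewrite !inE eqxx.
- by exists (u 1); apply/mem; exists 1; rewrite // (ltn_trans _ l3).
- by exists (u 1); apply/mem; left; exists 1; rewrite // (ltn_trans _ l3).
Qed.

(** Any type enumerating [A] is allowed, so that the induction hypothesis applies to the subtype
    left after removing the last piece. *)
Lemma piece_tree_inC (T : finType) (e : rel T) (A : {set T}) : symmetric e -> piece_tree e A ->
  forall (T' : finType) (f : T' -> T), injective f -> (forall x, x \in A <-> exists y, f y = x) ->
  inC (fun x y => e (f x) (f y)).
Proof.
move=> symE; elim=> {A} [X pX|A X a z tA IH pX dAX aX zA az one] T' f injf im.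
all: have [x0 x0X] := piece_nonempty pX.
all: have ee x y : (fun x y => e (f x) (f y)) x y = e (f x) (f y) by [].
  have [t0 _] : exists y, f y = x0 by apply/im.
  have EX : f @: [set: T'] = X.
    by apply/setP => x; apply/imsetP/idP => [[y _ ->]|/im[y <-]]; [apply/im; exists y| exists y].
  pose g y := odflt t0 [pick x | f x == y].
  have gK y : y \in X -> y = f (g y).
    move=> /im[x xy]; rewrite /g; case: pickP => [x' /eqP//|/(_ x)].
    by rewrite xy eqxx.
  case: pX => [[u [v [w p]]]|[l [u [p nl]]]|[l [idx [u [v [p vg]]]]]].
  - have [uX vX wX] : [/\ u \in X, v \in X & w \in X].
      by case: p => -> *; rewrite !inE !eqxx !orbT.
    apply: (@C0_P3 _ _ (g u) (g v) (g w)).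
    by apply/(P3_on_inj injf ee); rewrite EX -!gK.
  - apply: (@C0_cycle _ _ l (g \o u)) => //.
    have uf i : 0 < i <= l -> u i = f ((g \o u) i).
      by move=> il /=; rewrite -gK //; case: p => _ _ mem _; apply/mem; exists i.
    by apply/(cycle_on_inj injf ee _ uf); rewrite EX.
  - apply: (@C0_spiked _ _ l idx (g \o u) (g \o v)) => //.
    case: (p) => _ _ mem _.
    have uf i : 0 < i <= l -> u i = f ((g \o u) i).
      by move=> il /=; rewrite -gK //; apply/mem; left; exists i.
    have vf i : i \in idx -> v i = f ((g \o v) i).
      by move=> il /=; rewrite -gK //; apply/mem; right; exists i.
    by apply/(spiked_on_inj injf ee _ uf vf); rewrite EX.
have imX y : y \in X -> exists x, f x = y by move=> yX; apply/im; rewrite inE yX orbT.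
have imA y : y \in A -> exists x, f x = y by move=> yX; apply/im; rewrite inE yX.
have [t0 _] := imX _ x0X.
pose X' := f @^-1: X.
have EX : f @: X' = X.
  apply/setP => x; apply/imsetP/idP => [[y + ->]|xX]; first by rewrite inE.
  by have [y yx] := imX _ xX; exists y; rewrite ?inE yx.
pose g y := odflt t0 [pick x | f x == y].
have gK y : y \in X -> y = f (g y).
  move=> /imX[x xy]; rewrite /g; case: pickP => [x' /eqP//|/(_ x)].
  by rewrite xy eqxx.
have [z' zz] := imA _ zA.
have nAX x : x \in A -> x \in X -> False by move=> xA; rewrite (disjointFr dAX).
have fA x : x \notin X' -> f x \in A.
  rewrite inE => fX; have : f x \in A :|: X by apply/im; exists x.
  by rewrite inE (negPf fX) orbF.
have att b : b \in X -> b = a -> attached (fun x y => e (f x) (f y)) X' (g b) z'.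
  move=> bX ba; split; first by rewrite inE -gK.
    by rewrite inE zz; apply/negP => /nAX; apply.
  move=> x y xX /fA yA; have {}xX : f x \in X by move: xX; rewrite inE.
  split=> [xy|[-> ->]]; last by rewrite -gK // zz ba.
  have [E1 E2] := one _ _ xX yA xy.
  by split; apply: injf; rewrite ?zz // -gK // ba.
have rec : inC (@del_rel T' (fun x y => e (f x) (f y)) X').
  apply: (IH (rest X') (f \o val)); first by move=> x y /injf/val_inj.
  move=> x; split=> [xA|[y <-]]; last by apply: fA; apply: (valP y).
  have [y yx] := imA _ xA; have yX : y \notin X'.
    by rewrite inE yx; apply/negP => /nAX; apply.
  by exists (Sub y yX).
case: pX => [[u [v [w p]]]|[l [u [p nl]]]|[l [idx [u [v [p vg]]]]]].
- have [uX vX wX] : [/\ u \in X, v \in X & w \in X].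
    by case: p => -> *; rewrite !inE !eqxx !orbT.
  have tr (b c d : T) : b \in X -> c \in X -> d \in X -> P3_on e X b c d ->
      P3_on (fun x y => e (f x) (f y)) X' (g b) (g c) (g d).
    by move=> bX cX dX pp; apply/(P3_on_inj injf ee); rewrite EX -!gK.
  have : a \in [set u; v; w] by case: p => <-.
  (* A P_3 attached at an end is O1, up to reversal; attached at its middle it is O2. *)
  rewrite !inE -orbA => /or3P[]/eqP Ea.
  + by apply: (C_O1 (tr _ _ _ wX vX uX (P3_on_rev p)) (att u _ _) rec).
  + by apply: (C_O2 (tr _ _ _ uX vX wX p) (att v _ _) rec).
  + by apply: (C_O1 (tr _ _ _ uX vX wX p) (att w _ _) rec).
- apply: (@C_O3 _ _ X' l (g \o u) (g a) z') => //; last exact: att.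
  have uf i : 0 < i <= l -> u i = f ((g \o u) i).
    by move=> il /=; rewrite -gK //; case: p => _ _ mem _; apply/mem; exists i.
  by apply/(cycle_on_inj injf ee _ uf); rewrite EX.
- apply: (@C_O4 _ _ X' l idx (g \o u) (g \o v) (g a) z') => //; last exact: att.
  case: (p) => _ _ mem _.
  have uf i : 0 < i <= l -> u i = f ((g \o u) i).
    by move=> il /=; rewrite -gK //; apply/mem; left; exists i.
  have vf i : i \in idx -> v i = f ((g \o v) i).
    by move=> il /=; rewrite -gK //; apply/mem; right; exists i.
  by apply/(spiked_on_inj injf ee _ uf vf); rewrite EX.
Qed.

Lemma inC_piece_treeE (T : finType) (e : rel T) : symmetric e ->
  inC e <-> piece_tree e [set: T].
Proof.
move=> symE; split=> [/inC_piece_tree H|H].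
  by have := H T e id symE (@inj_id _) (fun _ _ => erefl); rewrite imset_id.
apply: (piece_tree_inC symE H (f := id)) => // x.
by split=> // _; exists x.
Qed.

(** * The equation over the rationals *)

Import GRing.Theory Num.Theory.
Local Open Scope ring_scope.

Theorem theorem3 (T : finType) (e : rel T) :
  symmetric e -> irreflexive e -> connected_graph e -> cycle_disjoint e ->
  ((diss e)%:R = (#|T|)%:R - ((n_edges e + 1 + c1 e)%N)%:R / 3 :> rat) <-> inC e.
Proof.
move=> symE irrE conE cdE.
have ratE : ((diss e)%:R = (#|T|)%:R - ((n_edges e + 1 + c1 e)%N)%:R / 3 :> rat) <->
    (3 * diss e + (n_edges e + 1 + c1 e) = 3 * #|T|)%N.
  move: (diss e) (n_edges e + 1 + c1 e)%N #|T| => d m n; split=> E.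
    apply/eqP; rewrite -(eqr_nat rat) natrD !natrM E mulrBr mulrCA divff // mulr1 subrK //.
  have /eqP := E; rewrite -(eqr_nat rat) natrD !natrM => /eqP {}E.
  by apply/eqP; rewrite eq_sym subr_eq -(inj_eq (mulfI (_ : 3%:R != 0 :> rat))) // mulrDr -E mulrCA divff // mulr1.
rewrite ratE inC_piece_treeE //.
(* [connected_graph] admits the empty graph; there the summand 1 refutes the equation, and pieces
   are nonempty. *)
have [T0|T0] := posnP #|T|.
  split=> [|pt]; first by rewrite T0; clear; lia.
  have : exists x : T, True.
    by elim: pt => [X /piece_nonempty[x _]|A X a z _ _ /piece_nonempty[x _] _ _ _ _ _]; exists x.
  by case=> x _; have := fintype0 x; rewrite T0 => /(_ erefl).
rewrite -(eq_tight symE irrE cdE conE T0); split=> [tT|/(piece_tree_tight symE cdE)].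
  apply: (tight_piece_tree symE irrE cdE _ _ tT); first exact: connT.
  by rewrite -card_gt0 cardsT.
by have := tau_bound symE irrE cdE [set: T]; clear; lia.
Qed.
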